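(* The following hold. (i) Every simple $\ell$-weight $\dot U'$-module can be obtained by twisting a simple $\ell$-weight $\dot U'$-module of type $1$ by an algebra automorphism of $\dot U'$. (ii) Every weight-finite simple $U_q(\mathrm L\mathfrak a_1)$-module is highest $\ell$-weight. (iii) Every weight-finite simple $U_q(\mathrm L\mathfrak a_1)$-module is finite-dimensional.
   Context: $\mathbb K$ is an algebraically closed field of characteristic $0$, $\mathbb F=\mathbb K(q)$, $\mathbb N=\{0,1,2,\dots\}$, $\mathbb N^\times=\mathbb N\setminus\{0\}$, $[n]_q=(q^n-q^{-n})/(q-q^{-1})$, $\delta(z)=\sum_{m\in\mathbb Z}z^m$. **The algebra $\dot U'$** (quantum affine algebra of type $\mathfrak a_1$ in Drinfel'd's presentation, without derivation; denoted $\dot{\mathrm U}_q'(\mathfrak a_1)$ in the paper) is the associative $\mathbb F$-algebra generated by $C^{1/2},C^{-1/2}$, $k^+_{n},k^-_{-n}$ ($n\in\mathbb N$), $x^+_{m},x^-_{m}$ ($m\in\mathbb Z$). Set $x^\pm(z)=\sum_{m\in\mathbb Z}x^\pm_m z^{-m}$, $k^\pm(z)=\sum_{n\in\mathbb N}k^\pm_{\pm n}z^{\mp n}$ and $G^\pm(z)=q^{\pm2}+(q-q^{-1})[\pm2]_q\sum_{m\ge1}q^{\pm2m}z^m\in\mathbb F[[z]]$. The relations are: $C^{\pm1/2}$ is central and $C^{1/2}C^{-1/2}=1$; $$k^\pm(z_1)k^\pm(z_2)=k^\pm(z_2)k^\pm(z_1),$$ $$k^-(z_1)k^+(z_2)=G^-(C^{-1}z_1/z_2)\,G^+(Cz_1/z_2)\,k^+(z_2)k^-(z_1),\qquad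 k^-_0k^+_0=k_0^+k_0^-=1,$$ $$G^\mp(C^{\mp1/2}z_2/z_1)\,k^+(z_1)x^\pm(z_2)=x^\pm(z_2)k^+(z_1),$$ $$k^-(z_1)x^\pm(z_2)=G^\mp(C^{\mp1/2}z_1/z_2)\,x^\pm(z_2)k^-(z_1),$$ $$(z_1-q^{\pm2}z_2)x^\pm(z_1)x^\pm(z_2)=(z_1q^{\pm2}-z_2)x^\pm(z_2)x^\pm(z_1),$$ $$[x^+(z_1),x^-(z_2)]=\tfrac1{q-q^{-1}}\Big[\delta\big(\tfrac{z_1}{Cz_2}\big)k^+(z_1C^{-1/2})-\delta\big(\tfrac{z_1C}{z_2}\big)k^-(z_2C^{-1/2})\Big].$$ $U_q(\mathrm L\mathfrak a_1)$ is the quotient of $\dot U'$ by the two-sided ideal generated by $C^{1/2}-1$ and $C^{-1/2}-1$; its modules are identified with the $\dot U'$-modules on which $C^{1/2}$ acts as the identity. $\dot U^0\subset\dot U'$ is the subalgebra generated by $C^{\pm1/2},k^+_n,k^-_{-n}$, $n\in\mathbb N$. **$\ell$-weight modules.** A $\dot U'$-module $M$ is $\ell$-weight if there is a countable family $\{M_\alpha:\alpha\in A\}$ of indecomposable locally finite-dimensional $\dot U^0$-modules (the $\ell$-weight spaces of $M$) with $M\cong\bigoplus_{\alpha\in A}M_\alpha$ as $\dot U^0$-modules. (Locally finite-dimensional: every vector lies in a finite-dimensional submodule.) To each $M_\alpha$ are associated scalars $\kappa_{\alpha,0}\in\mathbb F^\times$ and $\kappa^\pm_{\alpha,\pm m}\in\mathbb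 F$ ($m\in\mathbb N^\times$), with $\kappa^\pm_{\alpha,0}=\kappa_{\alpha,0}^{\pm1}$, such that every $v\in M_\alpha$ satisfies: there is $n\in\mathbb N^\times$ with $(k^\pm_{\pm m}-\kappa^\pm_{\alpha,\pm m}\,\mathrm{id})^n v=0$ for all $m\in\mathbb N$. Put $\mathrm{Sp}(M)=\{\kappa_{\alpha,0}:\alpha\in A\}$. $M$ is of type $1$ if $C^{1/2}$ acts as $\mathrm{id}$. $M$ is weight-finite if it is $\ell$-weight and $\mathrm{Sp}(M)$ is a finite set. **Highest $\ell$-weight.** A $\dot U'$-module $M$ is highest $\ell$-weight if $k^+_0$ acts semisimply on $M$, $C^{1/2}$ acts as $\mathrm{id}$, and there is $v\in M\setminus\{0\}$ with $x^+(z)v=0$, $k^\pm(z)v=\kappa^\pm(z)v$ for some $\kappa^\pm(z)\in\mathbb F[[z^{\mp1}]]$, and $M=\dot U'v$. Twisting a module by an automorphism $\phi$ means letting $x$ act through $\phi(x)$. *)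

(* Defs.v *)
From HB Require Import structures.
From mathcomp Require Import all_boot all_order all_algebra.
From mathcomp Require Import generic_quotient ring_quotient.
From mathcomp Require Import boolp classical_sets cardinality.
From mathcomp Require Import ring zify.
From mathcomp.multinomials Require Import monalg.

Set Implicit Arguments.
Unset Strict Implicit.
Unset Printing Implicit Defensive.

Import Order.TTheory GRing.Theory.
Local Open Scope classical_set_scope.
Local Open Scope ring_scope.
Local Open Scope quotient_scope.

Section Ideals.
Variables (F : fieldType) (A : algType F).

Definition two_sided_ideal (I : set A) : Prop :=
  [/\ I 0, forall x y, I x -> I y -> I (x - y)
    & forall a x, I x -> I (a * x) /\ I (x * a)].

Definition generated_ideal (S : set A) : set A := smallest two_sided_ideal S.

Lemma generated_idealP (S : set A) : two_sided_ideal (generated_ideal S).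
Proof.
split=> [I [[]] //|x y Ix Iy I SI|a x Ix].
  by case: (SI) => -[_ + _] _; apply; [apply: Ix|apply: Iy].
by split=> I SI; case: (SI) => -[_ _ /(_ a x (Ix _ SI))[]].
Qed.

Record proper_ideal := ProperIdeal {
  ideal_set :> set A;
  ideal_setP : two_sided_ideal ideal_set;
  ideal_set1 : ~ ideal_set 1 }.

Definition ideal_pred (I : proper_ideal) : {pred A} := fun x => `[< ideal_set I x >].

Lemma ideal_pred_zmod (I : proper_ideal) : zmod_closed (ideal_pred I).
Proof.
case: I => I [I0 IB IM] I1; split; first exact/asboolP.
by move=> x y /asboolP Ix /asboolP Iy; apply/asboolP/IB.
Qed.

HB.instance Definition _ (I : proper_ideal) :=
  GRing.isZmodClosed.Build A (ideal_pred I) (ideal_pred_zmod I).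

Definition quot_alg (I : proper_ideal) : Type := Quotient.quot (ideal_pred I).

End Ideals.

Section QuotientAlgebra.
Variables (F : fieldType) (A : algType F) (I : proper_ideal A).
Local Notation Q := (quot_alg I).

HB.instance Definition _ := GRing.Zmodule.on Q.
HB.instance Definition _ := EqQuotient.on Q.

Definition quot_one : Q := \pi_Q 1.
Definition quot_mul (x y : Q) : Q := \pi_Q (repr x * repr y : A).
Definition quot_scale (c : F) (x : Q) : Q := \pi_Q (c *: repr x).

Lemma quot_eq (x y : A) : ideal_set I (x - y) -> \pi_Q x = \pi_Q y.
Proof. by move=> Ixy; apply/eqmodP/asboolP. Qed.

Lemma quot_repr (x : A) : ideal_set I (repr (\pi_Q x) - x).
Proof.
by apply/asboolP; have := reprK (\pi_Q x) => /eqmodP.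
Qed.

Lemma quot_piD (x y : A) : \pi_Q (x + y) = \pi_Q x + \pi_Q y.
Proof. by rewrite !piE. Qed.

Lemma quot_piM (x y : A) : \pi_Q (x * y) = quot_mul (\pi_Q x) (\pi_Q y).
Proof.
apply/esym/quot_eq; have [I0 IB IM] := ideal_setP I.
have -> : repr (\pi_Q x) * repr (\pi_Q y) - x * y
   = (repr (\pi_Q x) - x) * repr (\pi_Q y) - x * (- (repr (\pi_Q y) - y)).
  by rewrite mulrN opprK mulrBl mulrBr addrA subrK.
apply: IB; first by have [] := IM (repr (\pi_Q y)) _ (quot_repr x).
by have [+ _] := IM (- x) _ (quot_repr y); rewrite mulNr mulrN.
Qed.

Lemma quot_piZ (c : F) (x : A) : \pi_Q (c *: x) = quot_scale c (\pi_Q x).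
Proof.
apply/esym/quot_eq; rewrite -scalerBr -[_ - x]mul1r scalerAl.
by have [_ _ IM] := ideal_setP I; have [] := IM (c *: 1) _ (quot_repr x).
Qed.

Lemma quot_mulA : associative quot_mul.
Proof.
elim/quotW=> x; elim/quotW=> y; elim/quotW=> z.
by rewrite -(quot_piM x y) -(quot_piM y z) -2!quot_piM mulrA.
Qed.

Lemma quot_mul1l : left_id quot_one quot_mul.
Proof. by elim/quotW=> x; rewrite -(quot_piM 1 x) mul1r. Qed.

Lemma quot_mul1r : right_id quot_one quot_mul.
Proof. by elim/quotW=> x; rewrite -(quot_piM x 1) mulr1. Qed.

Lemma quot_mulDl : left_distributive quot_mul +%R.
Proof.
elim/quotW=> x; elim/quotW=> y; elim/quotW=> z.
by rewrite -quot_piD -(quot_piM x z) -(quot_piM y z) -quot_piD -quot_piM mulrDl.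
Qed.

Lemma quot_mulDr : right_distributive quot_mul +%R.
Proof.
elim/quotW=> x; elim/quotW=> y; elim/quotW=> z.
by rewrite -quot_piD -(quot_piM x y) -(quot_piM x z) -quot_piD -quot_piM mulrDr.
Qed.

Lemma quot_one_neq0 : quot_one != 0.
Proof.
apply/eqP => e; apply: (ideal_set1 (p := I)).
have /eqmodP/asboolP : \pi_Q 1 = \pi_Q 0 by rewrite [LHS]e piE.
by rewrite subr0.
Qed.

HB.instance Definition _ := GRing.Zmodule_isNzRing.Build Q
  quot_mulA quot_mul1l quot_mul1r quot_mulDl quot_mulDr quot_one_neq0.

Lemma quot_scaleA (a b : F) (x : Q) :
  quot_scale a (quot_scale b x) = quot_scale (a * b) x.
Proof. by elim/quotW: x => x; rewrite -(quot_piZ b x) -(quot_piZ (a * b) x) -quot_piZ scalerA. Qed.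

Lemma quot_scale1 : left_id 1 quot_scale.
Proof. by elim/quotW=> x; rewrite -quot_piZ scale1r. Qed.

Lemma quot_scaleDr : right_distributive quot_scale +%R.
Proof.
move=> a; elim/quotW=> x; elim/quotW=> y.
by rewrite -quot_piD -(quot_piZ a x) -(quot_piZ a y) -quot_piD -quot_piZ scalerDr.
Qed.

Lemma quot_scaleDl (x : Q) : {morph quot_scale^~ x : a b / a + b}.
Proof.
move=> a b; elim/quotW: x => x.
by rewrite -(quot_piZ a x) -(quot_piZ b x) -quot_piD -quot_piZ scalerDl.
Qed.

HB.instance Definition _ := GRing.Zmodule_isLmodule.Build F Q
  quot_scaleA quot_scale1 quot_scaleDr quot_scaleDl.

Lemma quot_scaleAl (a : F) (x y : Q) : a *: (x * y) = (a *: x) * y.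
Proof.
elim/quotW: x => x; elim/quotW: y => y.
suff: quot_scale a (quot_mul (\pi_Q x) (\pi_Q y))
    = quot_mul (quot_scale a (\pi_Q x)) (\pi_Q y) by [].
by rewrite -(quot_piM x y) -(quot_piZ a x) -quot_piZ -quot_piM scalerAl.
Qed.

HB.instance Definition _ := GRing.Lmodule_isLalgebra.Build F Q quot_scaleAl.

Lemma quot_scaleAr (a : F) (x y : Q) : a *: (x * y) = x * (a *: y).
Proof.
elim/quotW: x => x; elim/quotW: y => y.
suff: quot_scale a (quot_mul (\pi_Q x) (\pi_Q y))
    = quot_mul (\pi_Q x) (quot_scale a (\pi_Q y)) by [].
by rewrite -(quot_piM x y) -(quot_piZ a y) -quot_piZ -quot_piM scalerAr.
Qed.

HB.instance Definition _ := GRing.Lalgebra_isAlgebra.Build F Q quot_scaleAr.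

End QuotientAlgebra.

Section FreeAlgebra.
Variables (F : fieldType) (X : choiceType).

Lemma free_scalerAr (c : F) (x y : {malg F[{fmonom X}]}) :
  c *: (x * y) = x * (c *: y).
Proof.
have mulC (z : {malg F[{fmonom X}]}) : z * c%:MP = c *: z.
  rewrite malgM_def malgZ_def fgmulgU; apply: eq_bigr => i _.
  by rewrite mulm1 mulrC.
by rewrite -!mul_malgC mulrA mul_malgC -mulC mulrA.
Qed.

(* The type of noncommutative polynomials. Monalg provides the algebra structure
   of monoid algebras over commutative monoids only. *)
Definition free_alg : Type := {malg F[{fmonom X}]}.

HB.instance Definition _ := GRing.Lalgebra.on free_alg.
HB.instance Definition _ :=
  GRing.Lalgebra_isAlgebra.Build F free_alg free_scalerAr.

Definition free_gen (x : X) : free_alg := mkmalgU (fmu x) 1.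

End FreeAlgebra.

(* A sign is encoded by a boolean, [true] for + and [false] for -. *)
Definition sgn (b : bool) : int := if b then 1 else -1.

(* [gC b] is C^{b 1/2}, [gk b n] is k^b_{b n} and [gx b m] is x^b_m. *)
Inductive gen := gC of bool | gk of bool & nat | gx of bool & int.

Definition gen_code (x : gen) : bool + (bool * nat) + (bool * int) :=
  match x with
  | gC b => inl (inl b)
  | gk b n => inl (inr (b, n))
  | gx b m => inr (b, m)
  end.

Definition gen_decode (x : bool + (bool * nat) + (bool * int)) : gen :=
  match x with
  | inl (inl b) => gC b
  | inl (inr (b, n)) => gk b n
  | inr (b, m) => gx b m
  end.

Lemma gen_codeK : cancel gen_code gen_decode.
Proof. by case. Qed.

HB.instance Definition _ := Countable.copy gen (can_type gen_codeK).

Section DrinfeldRelations.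
Variables (F : fieldType) (q : F).

Definition qint (n : int) : F := (q ^ n - q ^ (- n)) / (q - q^-1).

(* The coefficient of z^m in G^b(z). *)
Definition Gcoef (b : bool) (m : nat) : F :=
  if m == 0%N then q ^ (sgn b * 2)
  else (q - q^-1) * qint (sgn b * 2) * q ^ (sgn b * 2 * m%:Z).

Section Relations.
Variables (A : algType F) (g : gen -> A).

(* C^{j/2} *)
Definition Chalf (j : int) : A := g (gC (0 <= j)) ^+ `|j|%N.

(* k^b_n for every integer n, with k^+_n = 0 if n < 0 and k^-_n = 0 if n > 0. *)
Definition kmode (b : bool) (n : int) : A :=
  if 0 <= sgn b * n then g (gk b `|n|%N) else 0.

(* The defining relations, as pairs of sides, obtained by comparing the
   coefficients of the generating series: of z1^{-b m} z2^{-b n} in [rel_kk],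
   of z1^m z2^{-n} in [rel_kmkp], of z1^{-n} z2^{-m} in [rel_kpx],
   of z1^n z2^{-m} in [rel_kmx] and of z1^{-m} z2^{-n} in [rel_xx], [rel_xpxm].
   All the products of series reduce to finite sums: in [rel_kmkp] the inner
   sum over i is the coefficient of w^r in G^-(C^{-1} w) G^+(C w). *)
Inductive drinfeld_rel : A -> A -> Prop :=
| rel_C_central b x : drinfeld_rel (g (gC b) * g x) (g x * g (gC b))
| rel_CCV : drinfeld_rel (g (gC true) * g (gC false)) 1
| rel_kk b m n :
    drinfeld_rel (g (gk b m) * g (gk b n)) (g (gk b n) * g (gk b m))
| rel_kmkp m n :
    drinfeld_rel (g (gk false m) * g (gk true n))
      (\sum_(r < (minn m n).+1) \sum_(i < r.+1)
         (Gcoef false i * Gcoef true (r - i)) *: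
           (Chalf (- (2 * i%:Z)) * Chalf (2 * (r - i)%N%:Z)
            * g (gk true (n - r)) * g (gk false (m - r))))
| rel_k0 b : drinfeld_rel (g (gk b 0) * g (gk (~~ b) 0)) 1
| rel_kpx b n m :
    drinfeld_rel
      (\sum_(r < n.+1) Gcoef (~~ b) r *:
         (Chalf (- (sgn b * r%:Z)) * g (gk true (n - r)) * g (gx b (m + r%:Z))))
      (g (gx b m) * g (gk true n))
| rel_kmx b n m :
    drinfeld_rel (g (gk false n) * g (gx b m))
      (\sum_(r < n.+1) Gcoef (~~ b) r *:
         (Chalf (- (sgn b * r%:Z)) * g (gx b (m - r%:Z)) * g (gk false (n - r))))
| rel_xx b m n :
    drinfeld_rel
      (g (gx b (m + 1)) * g (gx b n)
         - q ^ (sgn b * 2) *: (g (gx b m) * g (gx b (n + 1))))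
      (q ^ (sgn b * 2) *: (g (gx b n) * g (gx b (m + 1)))
         - g (gx b (n + 1)) * g (gx b m))
| rel_xpxm m n :
    drinfeld_rel (g (gx true m) * g (gx false n) - g (gx false n) * g (gx true m))
      ((q - q^-1)^-1 *: (Chalf (m - n) * kmode true (m + n)
                         - Chalf (n - m) * kmode false (m + n))).

End Relations.

Definition drinfeld_relators : set (free_alg F gen) :=
  [set z | exists l r, drinfeld_rel (@free_gen F gen) l r /\ z = l - r].

(* Properness of the ideal: the trivial one-dimensional representation. *)

Definition triv (x : gen) : F :=
  match x with gC _ => 1 | gk _ n => (n == 0%N)%:R | gx _ _ => 0 end.

Definition triv_monom (m : {fmonom gen}) : F := \prod_(x <- m) triv x.

Lemma triv_monomM : mmorphism triv_monom.
Proof.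
split=> [x y|]; first by rewrite /triv_monom fmM big_cat.
by rewrite /triv_monom fm1 big_nil.
Qed.

HB.instance Definition _ := isMultiplicative.Build _ _ triv_monom triv_monomM.

Definition triv_ev : free_alg F gen -> F := mmap idfun triv_monom.

HB.instance Definition _ :=
  GRing.isZmodMorphism.Build (free_alg F gen) F triv_ev (@mmap_is_additive _ _ _ _ _).

Lemma triv_ev_monoid : GRing.monoid_morphism triv_ev.
Proof.
pose f : {rmorphism {malg F[{fmonom gen}]} -> F} := mmap idfun triv_monom.
by split; [exact: (rmorph1 f)|exact: (rmorphM f)].
Qed.

HB.instance Definition _ :=
  GRing.isMonoidMorphism.Build (free_alg F gen) F triv_ev triv_ev_monoid.

Lemma triv_evZ (c : F) (x : free_alg F gen) : triv_ev (c *: x) = c * triv_ev x.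
Proof. exact: mmap_is_linear. Qed.

Lemma triv_ev_gen (x : gen) : triv_ev (free_gen F x) = triv x.
Proof. by rewrite /triv_ev mmapU /= mul1r /triv_monom fmU big_seq1. Qed.

Hypothesis q0 : q != 0.

Lemma GcoefS b m :
  Gcoef b m.+1 = (q ^ (sgn b * 2) - q ^ (- (sgn b * 2))) * q ^ (sgn b * 2 * m.+1%:Z).
Proof.
rewrite /Gcoef /= /qint; have [e|qV] := eqVneq (q - q^-1) 0.
  rewrite e mul0r mul0r; suff -> : q ^ (sgn b * 2) = q ^ (- (sgn b * 2)).
    by rewrite subrr mul0r.
  by move/subr0_eq: e => e; rewrite -exprz_inv -e.
by rewrite [(q - q^-1) * _]mulrC divfK.
Qed.

Lemma Gcoef_conv n :
  \sum_(i < n.+1) Gcoef false i * Gcoef true (n - i) = (n == 0%N)%:R.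
Proof.
case: n => [|n].
  by rewrite big_ord_recl big_ord0 addr0 /Gcoef /= -expfzDr //.
rewrite big_ord_recl big_ord_recr /= subn0 subnn.
pose f i := q ^ (2 * (n%:Z - 2 * i%:Z)).
rewrite (eq_bigr (fun i : 'I_n => (q ^ 2 - q ^ (- 2)) * (f i.+1 - f i))); last first.
  move=> i _; rewrite /bump /= add1n subSS.
  have -> : (n - i = (n - i.+1).+1)%N by rewrite subnSK.
  rewrite !GcoefS /f.
  have ni : (n - i.+1).+1%:Z = n%:Z - i%:Z by have := ltn_ord i; lia.
  rewrite (_ : q ^ (sgn false * 2 * i.+1) = q ^ (- (2 * i%:Z)) * q ^ (-2)); last first.
    by rewrite -expfzDr //; congr (_ ^ _); rewrite /sgn; lia.
  rewrite (_ : q ^ (sgn true * 2 * _) = q ^ (2 * (n%:Z - i%:Z))); last first.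
    by congr (_ ^ _); rewrite /sgn ni; lia.
  rewrite (_ : q ^ (2 * (n%:Z - 2 * i.+1%:Z)) =
    q ^ (- (2 * i%:Z)) * q ^ (2 * (n%:Z - i%:Z)) * (q ^ (-2) * q ^ (-2))); last first.
    by rewrite -!expfzDr //; congr (_ ^ _); lia.
  rewrite (_ : q ^ (2 * (n%:Z - 2 * i%:Z)) =
    q ^ (- (2 * i%:Z)) * q ^ (2 * (n%:Z - i%:Z)) * (q ^ 2 * q ^ (-2))); last first.
    by rewrite -!expfzDr //; congr (_ ^ _); lia.
  rewrite (_ : sgn false * 2 = -2) // (_ : sgn true * 2 = 2) // opprK.
  by ring.
rewrite -mulr_sumr -(big_mkord xpredT (fun i => f i.+1 - f i)) telescope_sumr //.
rewrite /bump /= add1n !GcoefS /Gcoef /= /f.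
rewrite (_ : sgn false * 2 = -2) // (_ : sgn true * 2 = 2) // opprK.
rewrite (_ : q ^ (2 * n.+1%:Z) = q ^ 2 * q ^ (2 * n%:Z)); last first.
  by rewrite -expfzDr //; congr (_ ^ _); lia.
rewrite (_ : q ^ (-2 * n.+1%:Z) = q ^ (-2) * q ^ (- (2 * n%:Z))); last first.
  by rewrite -expfzDr //; congr (_ ^ _); lia.
rewrite (_ : 2 * (n%:Z - 2 * n%:Z) = - (2 * n%:Z)); last by lia.
rewrite (_ : 2 * (n%:Z - 2 * 0%:Z) = 2 * n%:Z); last by lia.
have uv : q ^ 2 * q ^ (-2) = 1 by rewrite -expfzDr.
set u := q ^ 2 in uv *; set v := q ^ (-2) in uv *; set W := q ^ _; set Z := q ^ _.
rewrite (_ : (_ + _ : F) = (u - v) * (u * v - 1) * (W - Z)); last by ring.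
by rewrite uv subrr mulr0 mul0r.
Qed.

Section TrivialRepresentation.
Variables (A : algType F) (g : gen -> A) (ev : {rmorphism A -> F}).
Hypothesis evZ : forall c x, ev (c *: x) = c * ev x.
Hypothesis ev_gen : forall x, ev (g x) = triv x.

Lemma ev_Chalf j : ev (Chalf g j) = 1.
Proof. by rewrite rmorphXn /= ev_gen expr1n. Qed.

Lemma ev_kmode b n : ev (kmode g b n) = (n == 0)%:R.
Proof.
rewrite /kmode; case: ifP => [_|]; first by rewrite ev_gen /= absz_eq0.
by rewrite rmorph0; case: eqVneq => // ->; rewrite mulr0 lexx.
Qed.

Lemma ev_rel l r : drinfeld_rel g l r -> ev l = ev r.
Proof.
case=> {l r} [b x||b m n|m n|b|b n m|b n m|b m n|m n].
- by rewrite !rmorphM mulrC.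
- by rewrite rmorphM !ev_gen rmorph1 mulr1.
- by rewrite !rmorphM mulrC.
- rewrite rmorphM !ev_gen /= rmorph_sum /=.
  under eq_bigr => r _.
    rewrite rmorph_sum /=; under eq_bigr => i _ do
      rewrite evZ !rmorphM !ev_Chalf !mul1r !ev_gen /=.
    rewrite -mulr_suml Gcoef_conv; over.
  rewrite big_ord_recl big1 => [|i _]; last by rewrite /= mul0r.
  by rewrite addr0 !subn0 mul1r mulrC.
- by rewrite rmorphM !ev_gen rmorph1 mulr1.
- rewrite rmorph_sum big1 => [|i _]; first by rewrite rmorphM !ev_gen /= mul0r.
  by rewrite evZ !rmorphM !ev_gen /= !mulr0.
- rewrite rmorph_sum big1 => [|i _]; first by rewrite rmorphM !ev_gen /= mulr0.
  by rewrite evZ !rmorphM [ev (g (gx _ _))]ev_gen /= mulr0 mul0r mulr0.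
- by rewrite !rmorphB !evZ !rmorphM !ev_gen /= !mulr0 subrr.
- rewrite evZ !rmorphB !rmorphM !ev_Chalf !ev_kmode.
  by rewrite subrr mulr0 !ev_gen /= mulr0 subrr.
Qed.

End TrivialRepresentation.

Lemma drinfeld_ideal_proper : ~ generated_ideal drinfeld_relators 1.
Proof.
move=> /(_ [set z | triv_ev z = 0]) /= H.
suff : triv_ev 1 = 0 by apply/eqP; rewrite [_ 1]rmorph1 oner_eq0.
apply: H; split; first split => [|x y ex ey|a x ex] /=.
- exact: rmorph0.
- by rewrite [LHS]rmorphB /= ex ey subrr.
- by split; rewrite [LHS]rmorphM /= ex ?mulr0 ?mul0r.
move=> _ [l [r [rlr ->]]] /=; rewrite [LHS]rmorphB.
by rewrite (ev_rel triv_evZ triv_ev_gen rlr) subrr.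
Qed.

Definition drinfeld_ideal : proper_ideal (free_alg F gen) :=
  ProperIdeal (generated_idealP drinfeld_relators) drinfeld_ideal_proper.

End DrinfeldRelations.

Section QuantumAffineAlgebra.
Variable K : closedFieldType.
Local Notation F := {fraction {poly K}}.

Definition qvar : F := tofrac 'X.

Lemma qvar_neq0 : qvar != 0.
Proof. by rewrite tofrac_eq0 polyX_eq0. Qed.

Definition Udot : Type := quot_alg (drinfeld_ideal qvar_neq0).

HB.instance Definition _ := GRing.Algebra.on Udot.

Definition Ugen (x : gen) : Udot :=
  \pi_(quot_alg (drinfeld_ideal qvar_neq0)) (free_gen F x).

Definition subalgebra (S : set Udot) : Prop :=
  [/\ S 1, forall x y, S x -> S y -> S (x - y),
      forall x y, S x -> S y -> S (x * y) & forall (c : F) x, S x -> S (c *: x)].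

Definition Udot0 : set Udot :=
  smallest subalgebra
    ([set Ugen (gC b) | b in [set: bool]] `|`
     [set Ugen (gk p.1 p.2) | p in [set: bool * nat]]).

End QuantumAffineAlgebra.

(* A module over an F-algebra A is an F-vector space through c |-> c%:A. *)
Section Modules.
Variables (F : fieldType) (A : algType F) (M : lmodType A).
Implicit Types (S : set A) (N W P : set M).

(* F-subspaces of M stable under all the elements of S; if S is a subalgebra,
   these are the S-submodules of M. *)
Definition stable_subspace S N : Prop :=
  [/\ N 0, forall u v, N u -> N v -> N (u + v),
      forall (c : F) u, N u -> N (c%:A *: u) & forall a u, S a -> N u -> N (a *: u)].

Definition finite_dim N : Prop :=
  exists (n : nat) (e : 'I_n -> M), (forall i, N (e i)) /\
    forall v, N v -> exists c : 'I_n -> F, v = \sum_i (c i)%:A *: e i.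

Definition irreducible_subspace S N : Prop :=
  [/\ stable_subspace S N, N != [set 0]
    & forall P, stable_subspace S P -> P `<=` N -> P = [set 0] \/ P = N].

Definition simple_module : Prop := irreducible_subspace [set: A] [set: M].

Definition indecomposable S W : Prop :=
  [/\ stable_subspace S W, W != [set 0]
    & forall P N, stable_subspace S P -> stable_subspace S N ->
      P `&` N = [set 0] -> [set u + v | u in P & v in N] = W ->
      P = [set 0] \/ N = [set 0]].

Definition locally_finite_dim S W : Prop :=
  forall v, W v -> exists N,
    [/\ stable_subspace S N, N `<=` W, finite_dim N & N v].

(* M is the internal direct sum of the family W. *)
Definition direct_sum_decomposition (I : choiceType) (W : I -> set M) : Prop :=
  (forall v, exists (s : seq I) (f : I -> M),
     (forall i, W i (f i)) /\ v = \sum_(i <- s) f i) /\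
  (forall (s : seq I) (f : I -> M), uniq s -> (forall i, W i (f i)) ->
     \sum_(i <- s) f i = 0 -> forall i, i \in s -> f i = 0).

(* M is a semisimple F[a]-module, i.e. the sum of its simple submodules. *)
Definition acts_semisimply (a : A) : Prop :=
  forall v, exists (n : nat) (w : 'I_n -> M), v = \sum_i w i /\
    forall i, exists N, irreducible_subspace [set a] N /\ N (w i).

End Modules.

Definition isomorphic_modules (R : pzRingType) (M N : lmodType R) : Prop :=
  exists f : {linear M -> N}, bijective f.

(* M with x in R acting as phi x. *)
Definition twist (R : pzRingType) (phi : {rmorphism R -> R}) (M : lmodType R) :
  Type := M.

Section Twist.
Variables (R : pzRingType) (phi : {rmorphism R -> R}) (M : lmodType R).

Local Notation twist := (twist phi M).

HB.instance Definition _ := GRing.Zmodule.on twist.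

Definition twist_scale (x : R) (v : twist) : twist := phi x *: (v : M).

Lemma twist_scaleA x y v : twist_scale x (twist_scale y v) = twist_scale (x * y) v.
Proof. by rewrite /twist_scale rmorphM scalerA. Qed.

Lemma twist_scale1 : left_id 1 twist_scale.
Proof. by move=> v; rewrite /twist_scale rmorph1 scale1r. Qed.

Lemma twist_scaleDr : right_distributive twist_scale +%R.
Proof. by move=> x u v; rewrite /twist_scale scalerDr. Qed.

Lemma twist_scaleDl v : {morph twist_scale^~ v : x y / x + y}.
Proof. by move=> x y; rewrite /twist_scale rmorphD scalerDl. Qed.

HB.instance Definition _ := GRing.Zmodule_isLmodule.Build R twist
  twist_scaleA twist_scale1 twist_scaleDr twist_scaleDl.

End Twist.

Section LWeightModules.
Variables (K : closedFieldType).
Local Notation F := {fraction {poly K}}.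
Local Notation U := (Udot K).
Variable M : lmodType U.

(* The modules of type 1 are the U_q(L a_1)-modules, U_q(L a_1) being the quotient
   of U by the ideal generated by C^{1/2} - 1 and C^{-1/2} - 1. *)
Definition type1 : Prop := forall v : M, Ugen K (gC true) *: v = v.

(* [W] is the family of the l-weight spaces of M and [kappa a b n] is the scalar
   kappa^b_{a, b n}. As F is not algebraically closed, the existence of these
   scalars in F is a condition on the l-weight spaces. *)
Record lweight_decomposition (I : countType) (W : I -> set M)
    (kappa : I -> bool -> nat -> F) : Prop := {
  lweight_direct_sum : direct_sum_decomposition W;
  lweight_indecomposable : forall a, indecomposable (@Udot0 K) (W a);
  lweight_locally_finite : forall a, locally_finite_dim (@Udot0 K) (W a);
  lweight_kappa_neq0 : forall a, kappa a true 0%N != 0;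
  lweight_kappa_inv : forall a, kappa a false 0%N = (kappa a true 0%N)^-1;
  lweight_kappa : forall a v, W a v -> exists2 n : nat, (0 < n)%N &
    forall b m, (Ugen K (gk b m) - (kappa a b m)%:A) ^+ n *: v = 0 }.

Definition lweight : Prop :=
  exists (I : countType) (W : I -> set M) kappa, lweight_decomposition W kappa.

Definition weight_finite : Prop :=
  exists (I : countType) (W : I -> set M) kappa, lweight_decomposition W kappa /\
    finite_set [set kappa a true 0%N | a in [set: I]].

Definition highest_lweight : Prop :=
  [/\ acts_semisimply M (Ugen K (gk true 0)), type1 &
      exists (v : M) (kappa : bool -> nat -> F),
      [/\ v != 0, forall m, Ugen K (gx true m) *: v = 0,
          forall b n, Ugen K (gk b n) *: v = (kappa b n)%:A *: v
        & forall w : M, exists x : U, w = x *: v]].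

End LWeightModules.

(* Main.v *)
(** Both k^-_1 and k^+_1 act on an l-weight space as a scalar plus a locally
nilpotent operator, and [k^-_1, k^+_1] = (q^2 - q^-2) (C - C^-1). By Schur's lemma
the central element C - C^-1 acts as zero or injectively; the latter would give
a locally nilpotent representation of the Weyl algebra. Hence C^{1/2} is a fourth
root of unity, and it is absorbed by an automorphism rescaling the generators.

For weight-finite modules of type 1, a common eigenvector v of the k^b_n in an
l-weight space whose weight is extremal is killed by the x^+_m. The spans L_j of
the vectors x^-_{m_1} ... x^-_{m_j} v add up to a submodule, hence to M, and lie in
distinct eigenspaces of k^+_0, so that k^+_0 is semisimple and L_j = 0 for some j.
Finite-dimensionality of L_{j+1} follows from that of L_j without Drinfeld
polynomials: k^{+-}_1 and x^-_m generate x^-_{m+-1}, so that x^-_m L_j is contained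
in any subspace stable under the k^b_n and containing x^-_0 L_j; a finite-dimensional
one exists by local finiteness. *)

From HB Require Import structures.
From mathcomp Require Import all_boot all_order all_algebra.
From mathcomp Require Import generic_quotient.
From mathcomp Require Import boolp classical_sets cardinality.
From mathcomp Require Import zify.
From mathcomp.multinomials Require Import monalg.
Require Import Defs.

Set Implicit Arguments.
Unset Strict Implicit.
Unset Printing Implicit Defensive.

Import GRing.Theory.
Local Open Scope classical_set_scope.
Local Open Scope ring_scope.
Local Open Scope quotient_scope.

(** * Universal property of the algebra *)

Section QuotientUniversal.
Variables (F : fieldType) (A : algType F) (I : proper_ideal A).

Definition quot_map (x : A) : quot_alg I := \pi_(quot_alg I) x.

Lemma quot_map_zmod : zmod_morphism quot_map.
Proof. by move=> x y; rewrite /quot_map !piE. Qed.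

Lemma quot_map_monoid : monoid_morphism quot_map.
Proof. by split=> // x y; exact: quot_piM. Qed.

Lemma quot_map_scalable : scalable quot_map.
Proof. by move=> c x; exact: quot_piZ. Qed.

HB.instance Definition _ :=
  GRing.isZmodMorphism.Build A (quot_alg I) quot_map quot_map_zmod.
HB.instance Definition _ :=
  GRing.isMonoidMorphism.Build A (quot_alg I) quot_map quot_map_monoid.
HB.instance Definition _ :=
  GRing.isScalable.Build F A (quot_alg I) *:%R quot_map quot_map_scalable.

Lemma quot_map_eq0 x : ideal_set I x -> quot_map x = 0.
Proof.
move=> Ix; rewrite -[RHS](raddf0 quot_map).
by apply: quot_eq; rewrite subr0.
Qed.

Lemma quot_mapP y : exists x, y = quot_map x.
Proof. by exists (repr y); rewrite /quot_map reprK. Qed.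

Variables (B : algType F) (f : {lrmorphism A -> B}).
Hypothesis If : forall x, ideal_set I x -> f x = 0.

Definition quot_lift (y : quot_alg I) : B := f (repr y).

Lemma quot_liftE x : quot_lift (quot_map x) = f x.
Proof. by have /If := @quot_repr _ _ I x; rewrite rmorphB => /subr0_eq. Qed.

Lemma quot_lift_zmod : zmod_morphism quot_lift.
Proof.
move=> y z; have [[u ->] [v ->]] := (quot_mapP y, quot_mapP z).
by rewrite -(rmorphB quot_map) !quot_liftE rmorphB.
Qed.

Lemma quot_lift_monoid : monoid_morphism quot_lift.
Proof.
split=> [|y z]; first by rewrite -(rmorph1 quot_map) quot_liftE rmorph1.
have [[u ->] [v ->]] := (quot_mapP y, quot_mapP z).
by rewrite -(rmorphM quot_map) !quot_liftE rmorphM.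
Qed.

Lemma quot_lift_scalable : scalable quot_lift.
Proof.
move=> c y; have [u ->] := quot_mapP y.
by rewrite -(quot_map_scalable c u) !quot_liftE linearZ.
Qed.

Lemma quot_lift_lrmorphism :
  {h : {lrmorphism quot_alg I -> B} | forall x, h (quot_map x) = f x}.
Proof.
pose m1 := GRing.isZmodMorphism.Build _ _ quot_lift quot_lift_zmod.
pose m2 := GRing.isMonoidMorphism.Build _ _ quot_lift quot_lift_monoid.
pose m3 := GRing.isScalable.Build F _ _ *:%R quot_lift quot_lift_scalable.
pose h : {lrmorphism quot_alg I -> B} := HB.pack quot_lift m1 m2 m3.
by exists h => x; exact: quot_liftE.
Qed.

End QuotientUniversal.

Section FreeAlgebraUniversal.
Variables (F : fieldType) (X : choiceType).

(** A noncommutative polynomial is a linear combination of words, each built letter by letter from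
    the left, in the order in which the generators act on a module. *)
Lemma free_alg_ind (P : free_alg F X -> Prop) :
  P 1 -> (forall x y, P x -> P y -> P (x + y)) -> (forall c x, P x -> P (c *: x)) ->
  (forall i x, P x -> P (free_gen F i * x)) -> forall x, P x.
Proof.
move=> P1 PD PZ Pg x; rewrite (monalgE x).
(* The empty sum is reached as a multiple of 1, which spares the principle a case for 0. *)
elim/big_ind: _ => [|//|m _]; first by rewrite -(scale0r (1 : free_alg F X)); exact: PZ.
have -> : (<< x@_m *g m >> : {malg F[{fmonom X}]}) = x@_m *: << m >>.
  by apply/malgP => k; rewrite mcoeffZ !mcoeffU mulrnAr mulr1.
apply: PZ; case: m => s; elim: s => [|i s IH].
  by rewrite -fmoneE.
have -> : FMonom (i :: s) = fmmul (fmu i) (FMonom s) by rewrite fmmulE fmuE.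
rewrite -[1](mulr1 1) -fgmulUU -malgM_def; exact: Pg.
Qed.

Variables (A : algType F) (g : X -> A).

Definition word_eval (m : {fmonom X}) : A := \prod_(x <- m) g x.

Lemma word_evalM : mmorphism word_eval.
Proof.
split=> [x y|]; first by rewrite /word_eval fmM big_cat.
by rewrite /word_eval fm1 big_nil.
Qed.

HB.instance Definition _ := isMultiplicative.Build _ _ word_eval word_evalM.

Definition free_lift : free_alg F X -> A := mmap (in_alg A) word_eval.

Lemma free_lift_zmod : zmod_morphism free_lift.
Proof. exact: mmap_is_additive. Qed.

Lemma free_lift_monoid : monoid_morphism free_lift.
Proof.
have [|M1 M2] := @commr_mmap_is_multiplicative _ F A (in_alg A) word_eval.
  by move=> x m m'; rewrite /GRing.comm mulr_algl mulr_algr.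
by split.
Qed.

Lemma free_lift_scalable : scalable free_lift.
Proof. by move=> c x; rewrite [LHS]mmapZ /= mulr_algl. Qed.

HB.instance Definition _ :=
  GRing.isZmodMorphism.Build (free_alg F X) A free_lift free_lift_zmod.
HB.instance Definition _ :=
  GRing.isMonoidMorphism.Build (free_alg F X) A free_lift free_lift_monoid.
HB.instance Definition _ :=
  GRing.isScalable.Build F (free_alg F X) A *:%R free_lift free_lift_scalable.

Lemma free_lift_gen x : free_lift (free_gen F x) = g x.
Proof. by rewrite [LHS]mmapU /= scale1r mul1r /word_eval fmU big_seq1. Qed.

End FreeAlgebraUniversal.

(** * Transport of the defining relations along algebra morphisms *)

Section RelationNaturality.
Variables (F : fieldType) (q : F) (A B : algType F) (f : {lrmorphism A -> B}).
Variables (gA : gen -> A) (gB : gen -> B).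
Hypothesis fg : forall x, f (gA x) = gB x.

Let fM x y : f (x * y) = f x * f y. Proof. exact: rmorphM. Qed.
Let fB x y : f (x - y) = f x - f y. Proof. exact: rmorphB. Qed.
Let fZ c x : f (c *: x) = c *: f x. Proof. exact: linearZ. Qed.
Let f1 : f 1 = 1. Proof. exact: rmorph1. Qed.

Let fsum n (E : 'I_n -> A) : f (\sum_i E i) = \sum_i f (E i).
Proof. exact: rmorph_sum. Qed.

Let f_Chalf j : f (Chalf gA j) = Chalf gB j.
Proof. by rewrite rmorphXn /= fg. Qed.

Let f_kmode b n : f (kmode gA b n) = kmode gB b n.
Proof. by rewrite /kmode; case: ifP; rewrite ?fg ?rmorph0. Qed.

Let fE := (fB, fM, fZ, f1, f_Chalf, f_kmode, fg).

Lemma drinfeld_rel_morph l r :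
  drinfeld_rel q gA l r -> drinfeld_rel q gB (f l) (f r).
Proof.
case=> {l r} [b x||b m n|m n|b|b n m|b n m|b m n|m n];
  rewrite ?fsum !fE; try by constructor.
- under eq_bigr => i _ do
    (rewrite fsum; under eq_bigr => k _ do rewrite !fE).
  by constructor.
- by under eq_bigr => i _ do rewrite !fE; constructor.
- by under eq_bigr => i _ do rewrite !fE; constructor.
Qed.

(** Meant for the projection [f] from the free algebra, where the relators live: a relation to be
    proved in the quotient is lifted to one between free generators. *)
Lemma drinfeld_rel_image l r : drinfeld_rel q gB l r ->
  exists l0 r0, [/\ drinfeld_rel q gA l0 r0, f l0 = l & f r0 = r].
Proof.
case=> {l r} [b x||b m n|m n|b|b n m|b n m|b m n|m n].
- by do 2!eexists; split; [apply: (rel_C_central _ _ b x)| |]; rewrite !fE.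
- by do 2!eexists; split; [apply: (rel_CCV _ _)| |]; rewrite !fE.
- by do 2!eexists; split; [apply: (rel_kk _ _ b m n)| |]; rewrite !fE.
- do 2!eexists; split; [apply: (rel_kmkp _ _ m n)| |]; rewrite ?fE // fsum.
  by apply: eq_bigr => i _; rewrite fsum; apply: eq_bigr => k _; rewrite !fE.
- by do 2!eexists; split; [apply: (rel_k0 _ _ b)| |]; rewrite !fE.
- do 2!eexists; split; [apply: (rel_kpx _ _ b n m)| |]; rewrite ?fE // fsum.
  by apply: eq_bigr => i _; rewrite !fE.
- do 2!eexists; split; [apply: (rel_kmx _ _ b n m)| |]; rewrite ?fE // fsum.
  by apply: eq_bigr => i _; rewrite !fE.
- by do 2!eexists; split; [apply: (rel_xx _ _ b m n)| |]; rewrite !fE.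
- by do 2!eexists; split; [apply: (rel_xpxm _ _ m n)| |]; rewrite !fE.
Qed.

End RelationNaturality.

Section UdotUniversal.
Variable K : closedFieldType.
Local Notation F := {fraction {poly K}}.
Local Notation q := (qvar K).
Local Notation I := (drinfeld_ideal (qvar_neq0 K)).

Lemma UgenE x : Ugen K x = quot_map I (free_gen F x).
Proof. by []. Qed.

Lemma Ugen_rel l r : drinfeld_rel q (Ugen K) l r -> l = r.
Proof.
move=> /(drinfeld_rel_image (fun x => esym (UgenE x))) [l0 [r0 [lr <- <-]]].
apply/subr0_eq; rewrite -(rmorphB (quot_map _)); apply: quot_map_eq0.
by move=> J [_]; apply; exists l0, r0.
Qed.

(** With [Ugen_rel] and [Udot_lift], this is the interface to the algebra: the sections over a
    general [U] assume what they use of it as [grel], [gind] and [glift]. *)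
Lemma Udot_ind (P : Udot K -> Prop) :
  P 1 -> (forall x y, P x -> P y -> P (x + y)) -> (forall c x, P x -> P (c *: x)) ->
  (forall i x, P x -> P (Ugen K i * x)) -> forall x, P x.
Proof.
move=> P1 PD PZ Pg y; have [x ->] := @quot_mapP _ _ I y.
elim/free_alg_ind: x => [|x z Px Pz|c x Px|i x Px].
- by rewrite rmorph1.
- by rewrite rmorphD; exact: PD.
- by rewrite linearZ; exact: PZ.
- by rewrite rmorphM; exact: Pg.
Qed.

(** The kernel of the evaluation on the free algebra is a two-sided ideal containing the relators,
    hence contains the ideal that they generate. *)
Lemma Udot_lift (A : algType F) (g : gen -> A) :
  (forall l r, drinfeld_rel q g l r -> l = r) ->
  {h : {lrmorphism Udot K -> A} | forall x, h (Ugen K x) = g x}.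
Proof.
move=> grel; have [|h hE] := @quot_lift_lrmorphism F _ I A (free_lift g).
  move=> x /(_ [set z | free_lift g z = 0]); apply; split.
    split=> [|u v eu ev|u v ev] /=; first exact: rmorph0.
      by rewrite rmorphB /= eu ev subrr.
    by split; rewrite rmorphM /= ev ?mulr0 ?mul0r.
  move=> _ [l [r [lr ->]]] /=; rewrite rmorphB; apply/eqP; rewrite subr_eq0.
  exact/eqP/grel/(drinfeld_rel_morph (free_lift_gen g) lr).
by exists h => x; rewrite UgenE hE; exact: free_lift_gen.
Qed.

End UdotUniversal.

(** * Subspaces *)

Section Subspaces.
Variables (F : fieldType) (U : algType F) (M : lmodType U).
Implicit Types (a : U) (c : F) (u v w : M) (S : set U) (N P : set M).

Lemma scale_algA c a v : (c *: a) *: v = c%:A *: (a *: v).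
Proof. by rewrite scalerA mulr_algl. Qed.

Lemma scale_algC c a v : a *: (c%:A *: v) = c%:A *: (a *: v).
Proof. by rewrite !scalerA mulr_algl mulr_algr. Qed.

Lemma scale_algM c d v : c%:A *: (d%:A *: v) = (c * d)%:A *: v.
Proof. by rewrite -scale_algA scalerA. Qed.

Lemma scale_algK c v : c != 0 -> c^-1%:A *: (c%:A *: v) = v.
Proof. by move=> c0; rewrite scale_algM mulVf // scale1r scale1r. Qed.

(** Commutation is asked at [v] only, because the k^+ and k^- are shown to commute on modules of
    type 1, not in the algebra. *)
Lemma shift_comm a b c d v : a *: (b *: v) = b *: (a *: v) ->
  (a - c%:A) *: ((b - d%:A) *: v) = (b - d%:A) *: ((a - c%:A) *: v).
Proof.
move=> ab; have expand a' b' c' d' : (a' - c'%:A) *: ((b' - d'%:A) *: v) =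
    (a' *: (b' *: v) - c'%:A *: (b' *: v)) - (d'%:A *: (a' *: v) - (c' * d')%:A *: v).
  rewrite (scalerBl b') (scalerBr (a' - _)) (scalerBl a' _ (b' *: v)).
  by rewrite (scalerBl a' _ (_ *: v)) scale_algC scale_algM.
by rewrite !expand ab [d * c]mulrC !opprD !addrA !opprK; congr (_ + _); rewrite addrAC.
Qed.

Lemma stable_subspaceN S N u : stable_subspace S N -> N u -> N (- u).
Proof. by case=> _ _ NZ _ Nu; have := NZ (- 1) u Nu; rewrite scaleN1r scaleN1r. Qed.

Lemma stable_subspaceB S N u v : stable_subspace S N -> N u -> N v -> N (u - v).
Proof. by move=> SN Nu Nv; have [_ + _ _] := SN; apply=> //; exact: stable_subspaceN SN _. Qed.

Lemma stable_subspace_sum S N (I : Type) (s : seq I) (Q : pred I) (f : I -> M) :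
  stable_subspace S N -> (forall i, Q i -> N (f i)) -> N (\sum_(i <- s | Q i) f i).
Proof. by case=> N0 ND _ _ Nf; elim/big_ind: _. Qed.

Lemma stable_subspaceW S S' N : S' `<=` S -> stable_subspace S N -> stable_subspace S' N.
Proof. by move=> sS [N0 ND NZ NS]; split=> // a u /sS; exact: NS. Qed.

(** The body of [finite_dim] with the number of vectors exposed, so that induction on this number
    replaces dimension theory. *)
Definition spanned n N : Prop := exists e : 'I_n -> M, (forall i, N (e i)) /\
  forall v, N v -> exists c : 'I_n -> F, v = \sum_i (c i)%:A *: e i.

Lemma stable_subspace0 S : stable_subspace S [set 0 : M].
Proof.
split=> //= [u v -> ->|c u ->|a u _ ->]; by rewrite ?addr0 ?scaler0.
Qed.

Lemma nonzero_vector N : N 0 -> N != [set 0] -> exists2 v, N v & v <> 0.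
Proof.
move=> N0 /eqP Nn0; apply: contra_notP Nn0 => /forall2NP NE.
by apply/seteqP; split=> [v Nv|v -> //]; case: (NE v) => // /contrapT.
Qed.

Lemma direct_sum_inhabited (I : choiceType) (W : I -> set M) :
  direct_sum_decomposition W -> [set: M] != [set 0] -> exists a : I, True.
Proof.
move=> [Wsum _] Mn0; have [//|u _ u0] := nonzero_vector _ Mn0.
have [s [f [_ uE]]] := Wsum u.
by case: s uE => [|i s] uE; [case: u0; rewrite uE big_nil|exists i].
Qed.

Lemma finite_dim0 : finite_dim [set 0 : M].
Proof.
exists 0%N, (fun=> 0); split=> // v ->; exists (fun=> 0); by rewrite big_ord0.
Qed.

Lemma stable_subspaceD S N P : stable_subspace S N -> stable_subspace S P ->
  stable_subspace S [set u + v | u in N & v in P].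
Proof.
move=> [N0 ND NZ NS] [P0 PD PZ PS]; split.
- by exists 0 => //; exists 0; rewrite ?addr0.
- move=> _ _ [u Nu [v Pv <-]] [u' Nu' [v' Pv' <-]].
  exists (u + u'); first exact: ND.
  by exists (v + v'); [exact: PD|rewrite addrACA].
- move=> c _ [u Nu [v Pv <-]]; exists (c%:A *: u); first exact: NZ.
  by exists (c%:A *: v); [exact: PZ|rewrite scalerDr].
- move=> a _ Sa [u Nu [v Pv <-]]; exists (a *: u); first exact: NS.
  by exists (a *: v); [exact: PS|rewrite scalerDr].
Qed.

Lemma finite_dimD N P : N 0 -> P 0 -> finite_dim N -> finite_dim P ->
  finite_dim [set u + v | u in N & v in P].
Proof.
move=> N0 P0 [n [e [Ne eN]]] [m [f [Pf fP]]].
exists (n + m)%N, (fun i => match fintype.split i with inl j => e j | inr j => f j end).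
split=> [i|_ [u /eN[c ->] [v /fP[d ->] <-]]].
  case: fintype.splitP => j _; first by exists (e j) => //; exists 0; rewrite ?addr0.
  by exists 0 => //; exists (f j); rewrite ?add0r.
exists (fun i => match fintype.split i with inl j => c j | inr j => d j end).
rewrite big_split_ord /=; congr (_ + _); apply: eq_bigr => i _.
  by rewrite (unsplitK (inl i)).
by rewrite (unsplitK (inr i)).
Qed.

Lemma finite_dim_sum S (n : nat) (L : nat -> set M) :
  (forall i, stable_subspace S (L i) /\ finite_dim (L i)) ->
  exists N, [/\ stable_subspace S N, finite_dim N & forall i, (i < n)%N -> L i `<=` N].
Proof.
move=> SL; elim: n => [|n [N [SN fN LN]]].
  by exists [set 0]; split=> //; [exact: stable_subspace0|exact: finite_dim0].
have [SLn fLn] := SL n; have [N0 _ _ _] := SN; have [L0 _ _ _] := SLn.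
exists [set u + v | u in N & v in L n]; split.
- exact: stable_subspaceD.
- exact: finite_dimD.
- move=> i; rewrite ltnS leq_eqVlt => /predU1P[->|/LN sN] u Lu.
    by exists 0 => //; exists u; rewrite ?add0r.
  by exists u; [exact: sN|exists 0; rewrite ?addr0].
Qed.

(** The inductive form makes inclusions of spans provable by rule induction, without handling finite
    sums. *)
Inductive span (X : set M) : set M :=
| span_zero : span X 0
| span_add u v : span X u -> span X v -> span X (u + v)
| span_scale c u : span X u -> span X (c%:A *: u)
| span_mem u : X u -> span X u.

Lemma span_stable X : stable_subspace set0 (span X).
Proof.
by split=> //; [exact: span_zero|exact: span_add|exact: span_scale].
Qed.

Lemma span_sub S X N : stable_subspace S N -> X `<=` N -> span X `<=` N.
Proof.
move=> [N0 ND NZ _] XN u; elim=> {u} // [u v _ Nu _ Nv|c u _ Nu].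
  exact: ND.
exact: NZ.
Qed.

Lemma preimage_stable a N : stable_subspace set0 N ->
  stable_subspace set0 [set u | N (a *: u)].
Proof.
move=> [N0 ND NZ _]; split=> //= [|u v Nu Nv|c u Nu].
- by rewrite scaler0.
- by rewrite scalerDr; exact: ND.
- by rewrite scale_algC; exact: NZ.
Qed.

Lemma span_act X N a : stable_subspace set0 N ->
  (forall u, X u -> N (a *: u)) -> forall u, span X u -> N (a *: u).
Proof. by move=> /(preimage_stable a) SN XN; exact: (span_sub SN). Qed.

(* A nilpotent operator kills a combination of the spanning vectors, so that
   its image is spanned by one vector less. *)
Lemma spanned_nilpotent_image n N a : stable_subspace [set a] N -> N != [set 0] ->
  spanned n.+1 N -> (forall v, N v -> exists m, a ^+ m *: v = 0) ->
  spanned n [set a *: v | v in N].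
Proof.
move=> SN Nn0 [e [Ne eN]] anil; have [N0 _ _ Na] := SN.
(* This is the last nonzero vector among the iterates a^i v. *)
have [w [Nw w0 aw]] : exists w, [/\ N w, w <> 0 & a *: w = 0].
  have [v Nv v0] := nonzero_vector N0 Nn0.
  have [m] := anil v Nv; elim: m v Nv v0 => [|m IH] v Nv v0.
    by rewrite expr0 scale1r.
  have [av|av] := pselect (a *: v = 0); first by exists v.
  by rewrite exprSr -scalerA; apply: IH => //; exact: Na.
have [c wE] := eN w Nw.
have [i ci] : exists i, c i != 0.
  apply/existsP; apply: contra_notT w0 => /existsPn c0.
  by rewrite wE big1 // => i _; move: (c0 i); rewrite negbK => /eqP ->; rewrite !scale0r.
exists (fun j => a *: e (lift i j)); split=> [j|_ [v /eN[d ->] <-]].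
  by exists (e (lift i j)).
(* As a w = 0 and c_i is nonzero, a e_i is a combination of the other a e_j; substituting it into a
   v gives these coefficients. *)
exists (fun j => d (lift i j) - d i / c i * c (lift i j)).
have sumE (f : 'I_n.+1 -> F) : a *: (\sum_j (f j)%:A *: e j) =
   (f i)%:A *: (a *: e i) + \sum_j (f (lift i j))%:A *: (a *: e (lift i j)).
  rewrite scaler_sumr (bigD1_ord i) //= scale_algC; congr (_ + _).
  by apply: eq_bigr => j _; rewrite scale_algC.
have aei : a *: e i = - ((c i)^-1%:A *: \sum_j (c (lift i j))%:A *: (a *: e (lift i j))).
  move: aw; rewrite wE sumE => /eqP; rewrite addr_eq0 => /eqP ce.
  by rewrite -scalerN -ce scale_algK.
rewrite sumE aei scalerN scale_algM addrC scaler_sumr -sumrB.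
by apply: eq_bigr => j _; rewrite scale_algM -scalerBl -scalerBl.
Qed.

Lemma spanned0 N : N 0 -> spanned 0 N -> N = [set 0].
Proof.
move=> N0 [e [_ eN]]; apply/seteqP; split=> v; last by move=> ->.
by move=> /eN[c ->]; rewrite big_ord0.
Qed.

(* In a nonzero stable subspace spanned by the least possible number of vectors,
   all the nilpotent operators vanish. *)
Lemma common_kernel (I : Type) (T : I -> U) N :
  (forall i j v, N v -> T i *: (T j *: v) = T j *: (T i *: v)) ->
  stable_subspace (range T) N -> N != [set 0] -> finite_dim N ->
  (forall i v, N v -> exists m, T i ^+ m *: v = 0) ->
  exists v, [/\ N v, v != 0 & forall i, T i *: v = 0].
Proof.
move=> Tcomm SN Nn0 [n]; rewrite -/(spanned n N).
elim/ltn_ind: n N Tcomm SN Nn0 => n IH N Tcomm SN Nn0 spN Tnil.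
have [N0 ND NZ NT] := SN.
have [T0|/existsNP[i Ti]] := pselect (forall i v, N v -> T i *: v = 0).
  have [v Nv v0] := nonzero_vector N0 Nn0.
  by exists v; split=> // [|i]; [exact/eqP|exact: T0].
case: n IH spN => [|n] IH spN; first by rewrite (spanned0 N0 spN) eqxx in Nn0.
(* The image of [T i] is stable because the operators commute, nonzero by the choice of [i], and
   spanned by one vector less, so that the induction applies to it. *)
pose P := [set T i *: v | v in N].
have PN : P `<=` N by move=> _ [v Nv <-]; apply: NT => //; exists i.
have [v [Pv v0 Tv]] : exists v, [/\ P v, v != 0 & forall i, T i *: v = 0].
  apply: (IH n) => //.
  - by move=> j k v /PN; exact: Tcomm.
  - split.
    + by exists 0; rewrite ?scaler0.
    + by move=> _ _ [u Nu <-] [v Nv <-]; exists (u + v); [exact: ND|rewrite scalerDr].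
    + by move=> c _ [u Nu <-]; exists (c%:A *: u); [exact: NZ|rewrite scale_algC].
    + move=> _ _ [j _ <-] [u Nu <-]; exists (T j *: u); last exact: Tcomm.
      by apply: NT => //; exists j.
  - apply/eqP => P0; apply: Ti => v Nv; have : P (T i *: v) by exists v.
    by rewrite P0.
  - apply: spanned_nilpotent_image => //; last by move=> v Nv; exact: Tnil.
    by apply: stable_subspaceW SN => _ ->; exists i.
  - by move=> j v /PN; exact: Tnil.
by exists v; split=> //; exact: PN.
Qed.

End Subspaces.

(** * Modules of type 1 *)

(** As c is not a root of unity, the points c^n a are pairwise distinct, and the first [(size s).+1]
    of them do not fit into a list [s]. *)
Lemma orbit_leaves_finite_set (F : fieldType) (S : set F) (c a : F) :
  finite_set S -> a != 0 -> c != 0 -> (forall n, (0 < n)%N -> c ^+ n != 1) ->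
  exists n, ~ S (c ^+ n * a).
Proof.
move=> /finite_seqP[s ->] a0 c0 cX; apply/existsNP => all_s.
pose t := [seq c ^+ n * a | n <- iota 0 (size s).+1].
have ts : {subset t <= s} by move=> _ /mapP[n _ ->]; exact: all_s.
suff /uniq_leq_size/(_ ts) : uniq t by rewrite size_map size_iota ltnn.
have cinj m n : (m < n)%N -> c ^+ m * a != c ^+ n * a.
  move=> mn; apply: contra (cX (n - m)%N _) => [/eqP/(mulIf a0) e|]; last by rewrite subn_gt0.
  apply/eqP; apply: (mulfI (expf_neq0 m c0)).
  by rewrite mulr1 -exprD subnKC // ltnW.
rewrite map_inj_uniq ?iota_uniq // => m n e.
by case: (ltngtP m n) => // /cinj; rewrite e eqxx.
Qed.

Section Type1Modules.
Variables (F : fieldType) (q : F) (U : algType F) (g : gen -> U).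
Hypothesis q0 : q != 0.
Hypothesis qX : forall n, (0 < n)%N -> q ^+ n != 1.
Hypothesis grel : forall l r, drinfeld_rel q g l r -> l = r.
Variable M : lmodType U.
Hypothesis C1 : forall v : M, g (gC true) *: v = v.
Implicit Types (u v w : M) (N : set M) (b : bool).

Local Notation k b n := (g (gk b n)).
Local Notation x b m := (g (gx b m)).

Lemma Gcoef0_neq0 b : Gcoef q b 0 != 0.
Proof. exact: expfz_neq0. Qed.

(** The coefficient is a power of q times q^2 - q^-2 up to sign, whose vanishing would give q^4 = 1.
    This is what later allows to solve for the shifted x_{m+-1}. *)
Lemma Gcoef1_neq0 b : Gcoef q b 1 != 0.
Proof.
rewrite GcoefS // mulf_neq0 ?expfz_neq0 // subr_eq0.
apply: contraTneq (qX (isT : 0 < 4)%N) => e; apply/negPn/eqP.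
have q2 : q ^ 2 = q ^ (- 2) by case: b e => /= [//|]; rewrite /sgn mulN1r opprK.
have -> : q ^+ 4 = q ^ 2 * q ^ 2 by rewrite -expfzDr.
by rewrite {2}q2 -expfzDr // subrr.
Qed.

Lemma C_act b v : g (gC b) *: v = v.
Proof.
case: b; first exact: C1.
by rewrite -{1}[v]C1 scalerA -(grel (rel_C_central _ _ true _)) (grel (rel_CCV _ _)) scale1r.
Qed.

Lemma Chalf_act j v : Chalf g j *: v = v.
Proof.
rewrite /Chalf; elim: `|j|%N => [|n IH]; first by rewrite expr0 scale1r.
by rewrite exprS -scalerA IH C_act.
Qed.

(** Once C acts trivially, the inner sums are the coefficients of G^-(w) G^+(w) = 1, so that only r
    = 0 contributes. *)
Lemma kmkp_act m n v :
  k false m *: (k true n *: v) = k true n *: (k false m *: v).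
Proof.
rewrite scalerA (grel (rel_kmkp q g m n)) scaler_suml.
rewrite big_ord_recl [X in _ + X]big1 => [|r _].
  have := Gcoef_conv q0 0; rewrite addr0 !big_ord1 => ->.
  by rewrite scale1r -!scalerA !Chalf_act !subn0.
rewrite scaler_suml.
rewrite (eq_bigr (fun i : 'I__ => (Gcoef q false i * Gcoef q true (lift ord0 r - i))%:A *:
    (k true (n - lift ord0 r) *: (k false (m - lift ord0 r) *: v)))) => [|i _].
  by rewrite -!scaler_suml Gcoef_conv // !scale0r.
by rewrite scale_algA; congr (_ *: _); rewrite -!scalerA !Chalf_act.
Qed.

Lemma k_comm b m b' n v : k b m *: (k b' n *: v) = k b' n *: (k b m *: v).
Proof.
have [->|] := eqVneq b b'; first by rewrite !scalerA (grel (rel_kk _ _ _ _ _)).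
by case: b b' => [] [] // _; rewrite kmkp_act.
Qed.

Lemma k0_inv b v : k b 0 *: (k (~~ b) 0 *: v) = v.
Proof. by rewrite scalerA (grel (rel_k0 _ _ _)) scale1r. Qed.

Lemma kpx_act b n m v : x b m *: (k true n *: v) =
  \sum_(r < n.+1) (Gcoef q (~~ b) r)%:A *: (k true (n - r) *: (x b (m + r%:Z) *: v)).
Proof.
rewrite scalerA -(grel (rel_kpx q g b n m)) scaler_suml; apply: eq_bigr => r _.
by rewrite scale_algA -!scalerA Chalf_act.
Qed.

Lemma kmx_act b n m v : k false n *: (x b m *: v) =
  \sum_(r < n.+1) (Gcoef q (~~ b) r)%:A *: (x b (m - r%:Z) *: (k false (n - r) *: v)).
Proof.
rewrite scalerA (grel (rel_kmx q g b n m)) scaler_suml; apply: eq_bigr => r _.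
by rewrite scale_algA -!scalerA Chalf_act.
Qed.

Lemma xpxm_act m n v : x true m *: (x false n *: v) =
  x false n *: (x true m *: v) + (q - q^-1)^-1%:A *:
    (kmode g true (m + n) *: v - kmode g false (m + n) *: v).
Proof.
rewrite !scalerA; apply/eqP; rewrite addrC -subr_eq; apply/eqP.
rewrite -scalerBl (grel (rel_xpxm q g m n)) scale_algA scalerBl -!scalerA.
by rewrite !Chalf_act.
Qed.

(** A set of generators in place of the subalgebra [Udot0]: on modules of type 1 the two have the
    same stable subspaces. *)
Definition kgens : set U := range (fun p : bool * nat => k p.1 p.2).

Lemma stable_kgensP N : stable_subspace kgens N <->
  stable_subspace set0 N /\ forall b n u, N u -> N (k b n *: u).
Proof.
split=> [SN|[[N0 ND NZ _] Nk]].
  split=> [|b n u Nu]; first exact: stable_subspaceW SN.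
  by case: SN => _ _ _; apply=> //; exists (b, n).
by split=> // _ u [[b n] _ <-]; exact: Nk.
Qed.

Lemma kmode_stable N b n u :
  stable_subspace kgens N -> N u -> N (kmode g b n *: u).
Proof.
move=> SN Nu; have [N0 _ _ _] := SN; rewrite /kmode; case: ifP => _; last by rewrite scale0r.
by apply: (proj2 (iffLR (stable_kgensP N) SN)).
Qed.

Definition weight (a : F) : set M := [set u | k true 0 *: u = a%:A *: u].

Lemma weight_stable a : stable_subspace kgens (weight a).
Proof.
apply/stable_kgensP; rewrite /weight; split=> [|b n u /= wu]; last first.
  by rewrite k_comm wu scale_algC.
split=> //= [|u v uw vw|c u uw]; first by rewrite !scaler0.
  by rewrite !scalerDr uw vw.
by rewrite scale_algC uw !scale_algM mulrC.
Qed.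

(** The case n = 0 of the relation between k^+ and x^b has a single term: k^+_0 commutes with x^b_m
    up to a power of q. *)
Lemma weight_x a b m u : weight a u -> weight (q ^ (sgn b * 2) * a) (x b m *: u).
Proof.
rewrite /weight /= => wu; have := kpx_act b 0 m u.
rewrite big_ord_recl big_ord0 addr0 /= subn0 addr0 wu scale_algC => e.
rewrite -scale_algM e scale_algM -expfzDr //.
have -> : sgn b * 2 + sgn (~~ b) * 2 = 0 by case: b {e}.
by rewrite expr0z scale1r scale1r.
Qed.

(* The relations between k^{+-}_1 and x_m allow to move m by one. *)
Lemma x_image_finite_dim b N :
  (forall v, exists L, [/\ stable_subspace kgens L, finite_dim L & L v]) ->
  stable_subspace kgens N -> finite_dim N ->
  exists L, [/\ stable_subspace kgens L, finite_dim L
    & forall m u, N u -> L (x b m *: u)].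
Proof.
move=> lf SN [n [e [Ne eN]]].
(* [finite_dim_sum] takes a family indexed by all naturals; from the index n on, the vector to be
   contained is 0. *)
pose L1 i := projT1 (cid (lf (if insub i is Some j then x b 0 *: e j else 0))).
have L1P i : [/\ stable_subspace kgens (L1 i), finite_dim (L1 i) &
    L1 i (if insub i is Some j then x b 0 *: e j else 0)].
  by rewrite /L1; case: cid.
have [|L [SL fL L1L]] := @finite_dim_sum _ _ _ kgens n L1.
  by move=> i; have [] := L1P i.
exists L; split=> //.
have [_ Nk] := iffLR (stable_kgensP N) SN.
have [SL0 Lk] := iffLR (stable_kgensP L) SL; have [L0 LD LZ _] := SL0.
have Lx0 u : N u -> L (x b 0 *: u).
  move=> /eN[c ->]; rewrite scaler_sumr; apply: (stable_subspace_sum _ SL) => j _.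
  rewrite scale_algC; apply: (LZ); apply: (L1L j (ltn_ord j)).
  by have [_ _] := L1P j; rewrite valK.
(* For n = 1 the relation with k^+ has two terms, in k^+_1 x_m and k^+_0 x_{m+1}; it is solved for
   the second, and k^+_0 is undone by k^-_0. *)
have up m u : (forall v, N v -> L (x b m *: v)) -> N u -> L (x b (m + 1) *: u).
  move=> Lm Nu; have := kpx_act b 1 m u.
  rewrite big_ord_recl big_ord1 /= subn0 subnn addr0 => /esym/(canRL (addKr _)) e1.
  have L1' : L (k true 0 *: (x b (m + 1) *: u)).
    rewrite -(scale_algK (k true 0 *: _) (Gcoef1_neq0 (~~ b))); apply: (LZ).
    rewrite e1 addrC; apply: (stable_subspaceB SL).
      by apply: (Lm); exact: Nk.
    by apply: (LZ); apply: (Lk); exact: Lm.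
  by rewrite -(k0_inv false (x b _ *: u)); exact: Lk.
(* The relation with k^-_1 is applied to k^+_0 u, so that the term x_{m-1} k^-_0 k^+_0 u reduces to
   x_{m-1} u. *)
have down m u : (forall v, N v -> L (x b m *: v)) -> N u -> L (x b (m - 1) *: u).
  move=> Lm Nu; have := kmx_act b 1 m (k true 0 *: u).
  rewrite big_ord_recl big_ord1 /= subn0 subnn subr0 (k0_inv false).
  move=> /esym/(canRL (addKr _)) e1.
  rewrite -(scale_algK (x b _ *: _) (Gcoef1_neq0 (~~ b))); apply: (LZ).
  rewrite e1 addrC; apply: (stable_subspaceB SL).
    by apply: (Lk); apply: (Lm); exact: Nk.
  by apply: (LZ); apply: (Lm); apply: (Nk); exact: Nk.
case=> m u; last rewrite NegzE.
  elim: m u => [//|m IH] u Nu.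
  by rewrite -addn1 PoszD; exact: up.
(* The negative integers are the -(m + 1), so the descent starts at -1, one step below x_0. *)
elim: m u => [|m IH] u Nu.
  by rewrite -[- _]add0r; exact: down.
rewrite (_ : - _ = - m.+1%:Z - 1); last by rewrite -addn1 PoszD opprD.
exact: down.
Qed.

(** * The layers below a highest vector *)

Section Layers.
Variables (v : M) (kap : bool -> nat -> F).
Hypothesis xv : forall m, x true m *: v = 0.
Hypothesis kv : forall b n, k b n *: v = (kap b n)%:A *: v.

(* [layer j] is the span of the vectors x^-_{m_1} ... x^-_{m_j} v. *)
Fixpoint layer (j : nat) : set M :=
  if j is i.+1 then span [set w | exists m u, layer i u /\ w = x false m *: u]
  else span [set v].

Lemma layer_stable0 j : stable_subspace set0 (layer j).
Proof. by case: j => [|j]; exact: span_stable. Qed.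

Lemma layer_x j m u : layer j u -> layer j.+1 (x false m *: u).
Proof. by move=> Lu; apply: span_mem; exists m, u. Qed.

(** By induction on j, moving the k^b_n to the right past x^-_m. For k^- the relation does this
    directly; for k^+ a second induction, on n, is used. *)
Lemma layer_stable j : stable_subspace kgens (layer j).
Proof.
apply/stable_kgensP; split; first exact: layer_stable0.
elim: j => [|j IH] b n u.
  apply: span_act => [|_ ->]; first exact: span_stable.
  by rewrite kv; apply: span_scale; exact: span_mem.
have SL := layer_stable0 j.+1; have [_ _ LZ _] := SL.
apply: span_act => // w [m [{}u [Lu ->]]]; case: b; last first.
  rewrite kmx_act; apply: (stable_subspace_sum _ SL) => r _.
  by apply: (LZ); apply: layer_x; exact: IH.
(* The relation expands x^-_m k^+_n u. It is solved for its term r = 0, and the others involve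
   k^+_{n-r} with r > 0 and x^-_{m+r}, whence the induction for all m at once. *)
elim/ltn_ind: n m => n IHn m; have := kpx_act false n m u.
rewrite big_ord_recl /= subn0 addr0 => /esym/(canRL (addrK _)) e.
rewrite -(scale_algK (k true n *: _) (Gcoef0_neq0 true)) e; apply: (LZ).
apply: (stable_subspaceB SL); first by apply: layer_x; exact: IH.
apply: (stable_subspace_sum _ SL) => r _; apply: (LZ); apply: (IHn).
by have := ltn_ord r; rewrite /= /bump; lia.
Qed.


Lemma layer_weight j : layer j `<=` weight ((q ^ (sgn false * 2)) ^+ j * kap true 0).
Proof.
elim: j => [|j IH]; apply: (span_sub (weight_stable _)).
  by move=> _ ->; rewrite expr0 mul1r; exact: kv.
move=> _ [m [u [/IH Lu ->]]]; rewrite exprS -mulrA; exact: weight_x.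
Qed.

(** Moving x^+_m past the leftmost x^-_n leaves a commutator made of modes of k^+ and k^-, which
    preserve the layer; at the bottom x^+ kills v. *)
Lemma layer_xp j m u : layer j u ->
  if j is i.+1 then layer i (x true m *: u) else x true m *: u = 0.
Proof.
elim: j m u => [|j IH] m.
  by apply: (span_act (stable_subspace0 M set0)) => _ ->; exact: xv.
have SL := layer_stable j; have [_ LD LZ _] := SL.
apply: (span_act (layer_stable0 _)) => _ [n [u [Lu ->]]]; rewrite xpxm_act; apply: (LD).
  (* In layer 0 the term x^-_n x^+_m u vanishes instead of coming back from a lower layer. *)
  case: j IH SL Lu {LD LZ} => [|j] IH SL Lu; last by apply: layer_x; exact: IH.
  by rewrite (IH _ _ Lu) scaler0; exact: span_zero.
by apply: (LZ); apply: (stable_subspaceB SL); exact: kmode_stable.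
Qed.

Lemma layer_vanish j n : layer j `<=` [set 0] -> layer (n + j) `<=` [set 0].
Proof.
move=> Lj; elim: n => // n IH; rewrite addSn.
apply: (span_sub (stable_subspace0 M set0)) => _ [m [u [/IH -> ->]]].
by rewrite scaler0.
Qed.

Definition layers : set M := span [set u | exists j, layer j u].

Hypothesis gind : forall P : U -> Prop, P 1 -> (forall a a', P a -> P a' -> P (a + a')) ->
  (forall c a, P a -> P (c *: a)) -> (forall i a, P a -> P (g i * a)) ->
  forall a, P a.

Lemma gen_stable N : stable_subspace set0 N ->
  (forall i u, N u -> N (g i *: u)) -> stable_subspace [set: U] N.
Proof.
move=> [N0 ND NZ _] Ng; split=> // a u _ Nu; elim/gind: a => [|a b Na Nb|c a Na|i a Na].
- by rewrite scale1r.
- by rewrite scalerDl; exact: ND.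
- by rewrite (scale_algA c a); exact: NZ.
- by rewrite -scalerA; exact: Ng.
Qed.

Lemma layers_stable : stable_subspace [set: U] layers.
Proof.
have SL := span_stable [set u | exists j, layer j u].
apply: gen_stable => // i; apply: (span_act SL) => u [j Lu]; case: i => [b|b n|[] m].
- by rewrite C_act; apply: span_mem; exists j.
- apply: span_mem; exists j.
  by have [_] := iffLR (stable_kgensP _) (layer_stable j); apply.
- have := layer_xp m Lu; case: j Lu => [|j] Lu; first by move->; exact: span_zero.
  by move=> Lxu; apply: span_mem; exists j.
- by apply: span_mem; exists j.+1; exact: layer_x.
Qed.

Hypotheses (Msimple : simple_module M) (v0 : v != 0).

Lemma simple_full N : stable_subspace [set: U] N -> N v -> N = [set: M].
Proof.
have [_ _ Mmin] := Msimple; move=> SN Nv.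
have [//|N0|//] := Mmin N SN; by move: Nv v0; rewrite N0 /= => ->; rewrite eqxx.
Qed.

Lemma cyclic w : exists a, w = a *: v.
Proof.
suff E : [set w | exists a, w = a *: v] = [set: M].
  by have : [set: M] w by []; rewrite -E.
apply: simple_full; last by exists 1; rewrite scale1r.
split=> [|_ _ [a ->] [b ->]|c _ [a ->]|a _ _ [b ->]].
- by exists 0; rewrite scale0r.
- by exists (a + b); rewrite scalerDl.
- by exists (c *: a); rewrite (scale_algA c a).
- by exists (a * b); rewrite scalerA.
Qed.

Lemma layers_full : layers = [set: M].
Proof.
apply: simple_full; first exact: layers_stable.
by apply: span_mem; exists 0%N; exact: span_mem.
Qed.

(** Since [acts_semisimply] asks for irreducible summands, eigenvectors enter it through the lines
    that they span. *)
Lemma line_irreducible a w : w != 0 -> weight a w ->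
  irreducible_subspace [set k true 0] (span [set w]).
Proof.
move=> w0 aw.
have lineP u : span [set w] u -> exists c : F, u = c%:A *: w.
  elim=> {u} [|_ _ _ [c ->] _ [d ->]|c _ _ [d ->]|_ ->].
  - by exists 0; rewrite !scale0r.
  - by exists (c + d); rewrite -scalerDl -scalerDl.
  - by exists (c * d); rewrite scale_algM.
  - by exists 1; rewrite !scale1r.
split.
- have [S0 SD SZ _] := span_stable [set w]; split=> // _ u -> /lineP[c ->].
  by rewrite scale_algC aw; do 2!apply: (SZ); exact: span_mem.
- apply/eqP => E; move/eqP: w0; apply.
  by have : span [set w] w by [exact: span_mem]; rewrite E.
- move=> P SP Pw; have [P0 _ PZ _] := SP.
  have [->|Pn0] := eqVneq P [set 0]; [by left|right].
  have [u Pu u0] := nonzero_vector P0 Pn0; have [c uE] := lineP u (Pw u Pu).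
  have c0 : c != 0 by apply/eqP => c0; apply: u0; rewrite uE c0 !scale0r.
  apply/seteqP; split=> // t /lineP[d ->].
  have -> : w = c^-1%:A *: u by rewrite uE scale_algK.
  by do 2!apply: (PZ).
Qed.

Lemma k0_semisimple : acts_semisimply M (k true 0).
Proof.
have kv0 : weight (kap true 0) v by exact: kv.
move=> w; have : layers w by rewrite layers_full.
elim=> {w} [|_ _ _ [n [e [-> eI]]] _ [m [f [-> fI]]]|c _ _ [n [e [-> eI]]]|w [j Lw]].
- by exists 0%N, (fun=> 0); split=> [|[]//]; rewrite big_ord0.
- exists (n + m)%N, (fun i => match fintype.split i with inl j => e j | inr j => f j end).
  split; last by move=> i; case: fintype.splitP.
  rewrite big_split_ord /=; congr (_ + _); apply: eq_bigr => i _.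
    by rewrite (unsplitK (inl i)).
  by rewrite (unsplitK (inr i)).
- exists n, (fun i => c%:A *: e i); split; first by rewrite scaler_sumr.
  move=> i; have [N [IN Ne]] := eI i; exists N; split=> //.
  by case: IN => -[_ _ NZ _] _ _; exact: NZ.
- exists 1%N, (fun=> w); split=> [|_]; first by rewrite big_ord1.
  (* A zero summand must still lie in some irreducible subspace; the line of v serves. *)
  have [->|w0] := eqVneq w 0.
    by exists (span [set v]); split; [exact: line_irreducible kv0|exact: span_zero].
  exists (span [set w]); split; last exact: span_mem.
  exact: (line_irreducible w0 (layer_weight Lw)).
Qed.

(** Each layer is enclosed in a finite-dimensional stable subspace, by applying [x_image_finite_dim]
    to the enclosure of the previous one. As the later layers vanish, finitely many enclosures add
    up to all of M, and no statement on subspaces of finite-dimensional spaces is involved. *)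
Lemma layers_finite_dim j :
  (forall v, exists L, [/\ stable_subspace kgens L, finite_dim L & L v]) ->
  layer j `<=` [set 0] -> finite_dim [set: M].
Proof.
move=> lf Lj.
have /choice[L LP] i : exists L, (stable_subspace kgens L /\ finite_dim L) /\ layer i `<=` L.
  elim: i => [|i [L [[SL fL] Li]]].
    have [L [SL fL Lv]] := lf v; exists L; split=> //.
    by apply: (span_sub SL) => _ ->.
  have [L' [SL' fL' L'x]] := x_image_finite_dim false lf SL fL; exists L'; split=> //.
  by apply: (span_sub SL') => _ [m [u [/Li Lu ->]]]; exact: L'x.
have [N [SN fN LN]] := finite_dim_sum j.+1 (fun i => proj1 (LP i)).
suff <- : N = [set: M] by [].
apply/seteqP; split=> // w _; have : layers w by rewrite layers_full.
apply: (span_sub SN) => u [i Lu].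
have [ij|ji] := ltnP i j.+1; first by apply: (LN i) => //; exact: (proj2 (LP i)).
have -> : u = 0 by rewrite -(subnK (ltnW ji)) in Lu; exact: layer_vanish Lu.
by case: SN.
Qed.

End Layers.

(** * Weight decompositions and highest vectors *)

Section Decomposition.
Variables (I : choiceType) (W : I -> set M) (kappa : I -> bool -> nat -> F).
Hypothesis Wsum : direct_sum_decomposition W.
Hypothesis Wk : forall a, stable_subspace kgens (W a).
Hypothesis Wkappa : forall a u, W a u -> exists2 n : nat, (0 < n)%N &
  forall b m, (k b m - (kappa a b m)%:A) ^+ n *: u = 0.

(** Spanning allows repeated indices whereas independence is stated for duplicate-free lists;
    repetitions are absorbed as multiplicities. *)
Lemma sum_uniq u : exists (s : seq I) (f : I -> M),
  [/\ uniq s, forall i, W i (f i) & u = \sum_(i <- s) f i].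
Proof.
have [s [f [Wf ->]]] := (proj1 Wsum) u.
exists (undup s), (fun i => f i *+ count_mem i s); split; first exact: undup_uniq.
  move=> i; have [W0 WD _ _] := Wk i; elim: (count _ _) => [|n IH]; first by rewrite mulr0n.
  by rewrite mulrS; exact: WD.
by rewrite -[LHS]big_undup_iterop_count.
Qed.

(** By independence each component of u is an eigenvector for the same a. On a nonzero component a
    power of k^+_0 - kappa vanishes and also acts as a power of a - kappa, so that kappa = a. *)
Lemma weight_in_spectrum a u : weight a u -> u != 0 -> exists i, kappa i true 0%N = a.
Proof.
move=> ua u0; have [s [f [us Wf uE]]] := sum_uniq u.
have fa i : i \in s -> weight a (f i).
  move=> si; apply/eqP; rewrite -subr_eq0; apply/eqP.
  apply: ((proj2 Wsum) s (fun i => k true 0 *: f i - a%:A *: f i) us) => // [j|].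
    have [_ _ WZ _] := Wk j; apply: (stable_subspaceB (Wk j)); last exact: WZ.
    by have [_] := iffLR (stable_kgensP _) (Wk j); apply.
  by rewrite sumrB -!scaler_sumr -uE ua subrr.
have [i si fi] : exists2 i, i \in s & f i != 0.
  apply: contra_notP (elimN eqP u0) => /forall2NP f0; rewrite uE big_seq big1 // => i si.
  by case: (f0 i) => // /negP; rewrite negbK => /eqP.
exists i; have [n _ /(_ true 0%N) kn] := Wkappa (Wf i).
have [//|ka] := eqVneq (kappa i true 0%N) a; move/eqP: fi => [].
have ka0 : a - kappa i true 0%N != 0 by rewrite subr_eq0 eq_sym.
rewrite -(scale_algK (f i) (expf_neq0 n ka0)).
suff -> : ((a - kappa i true 0%N) ^+ n)%:A *: f i = 0 by rewrite scaler0.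
rewrite -kn; elim: n {kn} => [|n IH]; first by rewrite !expr0 !scale1r.
rewrite exprS -scale_algM IH exprSr -scalerA -scale_algC; congr (_ *: _).
by rewrite [RHS]scalerBl (fa i si) -scalerBl -scalerBl.
Qed.

Lemma locally_finite_sum :
  (forall a u, W a u -> exists L, [/\ stable_subspace kgens L, finite_dim L & L u]) ->
  forall u, exists L, [/\ stable_subspace kgens L, finite_dim L & L u].
Proof.
move=> lf u; have [s [f [Wf ->]]] := (proj1 Wsum) u.
elim: s => [|i s [L [SL fL Ls]]].
  by exists [set 0]; split; rewrite ?big_nil //; [exact: stable_subspace0|exact: finite_dim0].
have [P [SP fP Pi]] := lf i _ (Wf i); have [[L0 _ _ _] [P0 _ _ _]] := (SL, SP).
exists [set u + v | u in P & v in L]; split.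
- exact: stable_subspaceD.
- exact: finite_dimD.
- by rewrite big_cons; exists (f i) => //; exists (\sum_(j <- s) f j).
Qed.

Hypothesis Wn0 : forall a, W a != [set 0].
Hypothesis kappa_neq0 : forall a, kappa a true 0%N != 0.
Hypothesis Wlf : forall a u, W a u -> exists L,
  [/\ stable_subspace kgens L, L `<=` W a, finite_dim L & L u].
Hypothesis spec_finite : finite_set [set kappa a true 0%N | a in [set: I]].

Lemma q_sgnX b n : (0 < n)%N -> (q ^ (sgn b * 2)) ^+ n != 1.
Proof.
move=> n0; case: b; rewrite /sgn.
  by rewrite mul1r -[q ^ 2]/(q ^+ 2) -exprM qX // muln_gt0.
by rewrite mulN1r -[q ^ - _]/(q ^- 2) exprVn -exprM invr_eq1 qX // muln_gt0.
Qed.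

Lemma weight_orbit_leaves b a : exists n, forall a',
  kappa a' true 0%N != (q ^ (sgn b * 2)) ^+ n * kappa a true 0%N.
Proof.
have [n spn] := orbit_leaves_finite_set spec_finite (kappa_neq0 a)
  (expfz_neq0 (sgn b * 2) q0) (q_sgnX b).
by exists n => a'; apply/eqP => a'E; apply: spn; exists a'.
Qed.

(** Otherwise the finite spectrum would be closed under multiplication by q^2 and contain an
    infinite orbit. *)
Lemma top_lweight_space : [set: M] != [set 0] -> exists a, forall a',
  kappa a' true 0%N != q ^ (sgn true * 2) * kappa a true 0%N.
Proof.
move=> Mn0; apply: contrapT => /forallNP top.
have next a : exists a', kappa a' true 0%N = q ^ (sgn true * 2) * kappa a true 0%N.
  apply: contrapT => /forallNP na; apply: (top a) => a'.
  by apply/eqP; exact: na.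
have [a0 _] := direct_sum_inhabited Wsum Mn0.
have [n nE] := weight_orbit_leaves true a0.
suff [a aE] : exists a, kappa a true 0%N = (q ^ (sgn true * 2)) ^+ n * kappa a0 true 0%N.
  by have := nE a; rewrite aE eqxx.
elim: n {nE} => [|n [a aE]]; first by exists a0; rewrite expr0 mul1r.
by have [a' a'E] := next a; exists a'; rewrite a'E aE mulrA -exprS.
Qed.

(** Local finiteness gives a finite-dimensional stable subspace of a top space, on which the shifted
    k^b_n commute and are nilpotent; their common kernel provides v. A nonzero x^+_m v would have a
    weight outside the spectrum. *)
Lemma highest_vector : [set: M] != [set 0] -> exists v a, [/\ v != 0,
  forall m, x true m *: v = 0 & forall b n, k b n *: v = (kappa a b n)%:A *: v].
Proof.
move=> /top_lweight_space[a topa].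
have [W0 _ _ _] := Wk a.
have [u Wu u0] := nonzero_vector W0 (Wn0 a).
have [N [SN NW fN Nu]] := Wlf Wu.
pose T (p : bool * nat) := k p.1 p.2 - (kappa a p.1 p.2)%:A.
have [|||||v [Nv v0 Tv]] := common_kernel (T := T) (N := N).
- by move=> [b m] [b' n] v _; apply: shift_comm; exact: k_comm.
- have [N0 ND NZ Nk] := SN; split=> // _ v [p _ <-] Nv; rewrite scalerBl.
  by apply: (stable_subspaceB SN); [apply: Nk => //; exists p|exact: NZ].
- by apply/eqP => N0; apply: u0; have := Nu; rewrite N0.
- exact: fN.
- by move=> p v /NW/Wkappa[n _ kn]; exists n; exact: kn.
exists v, a.
have kv b n : k b n *: v = (kappa a b n)%:A *: v.
  by apply/subr0_eq; rewrite -scalerBl; exact: (Tv (b, n)).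
split=> // m; apply/eqP; apply/negP => /negP xv0.
have wv : weight (kappa a true 0%N) v by exact: kv.
have [a' a'E] := weight_in_spectrum (weight_x true m wv) xv0.
by have := topa a'; rewrite a'E eqxx.
Qed.

Hypothesis gind : forall P : U -> Prop, P 1 -> (forall a a', P a -> P a' -> P (a + a')) ->
  (forall c a, P a -> P (c *: a)) -> (forall i a, P a -> P (g i * a)) ->
  forall a, P a.
Hypothesis Msimple : simple_module M.

Lemma weight_finite_highest : acts_semisimply M (k true 0) /\
  exists (v : M) (kap : bool -> nat -> F),
    [/\ v != 0, forall m, x true m *: v = 0,
        forall b n, k b n *: v = (kap b n)%:A *: v & forall w, exists a, w = a *: v].
Proof.
have [_ Mn0 _] := Msimple; have [v [a [v0 xv kv]]] := highest_vector Mn0; split.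
  exact: (k0_semisimple xv kv).
by exists v, (kappa a); split=> //; exact: cyclic.
Qed.

Lemma weight_finite_finite_dim : finite_dim [set: M].
Proof.
have [_ Mn0 _] := Msimple; have [v [a [v0 xv kv]]] := highest_vector Mn0.
(* Layer n has weight q^{-2n} kappa, which is outside the spectrum, so this layer is zero. *)
have [n spn] := weight_orbit_leaves false a.
apply: (@layers_finite_dim v (kappa a) xv kv gind Msimple v0 n) => [|u Lu].
  apply: locally_finite_sum => i u /Wlf[L [SL _ fL Lu]]; by exists L.
apply: contrapT => /eqP u0; have [a' a'E] := weight_in_spectrum (layer_weight kv Lu) u0.
by have := spn a'; rewrite a'E eqxx.
Qed.

End Decomposition.
End Type1Modules.

(** * The central charge and twisting *)

Section CentralCharacter.
Variables (F : fieldType) (q : F) (U : algType F) (g : gen -> U).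
Hypothesis q0 : q != 0.
Hypothesis q4 : q ^+ 4 != 1.
Hypothesis F0 : [pchar F] =i pred0.
Hypothesis grel : forall l r, drinfeld_rel q g l r -> l = r.
Hypothesis gind : forall P : U -> Prop, P 1 -> (forall a a', P a -> P a' -> P (a + a')) ->
  (forall c a, P a -> P (c *: a)) -> (forall i a, P a -> P (g i * a)) ->
  forall a, P a.
Variable M : lmodType U.
Hypothesis Msimple : simple_module M.
Implicit Types (a b z : U) (u v w : M).

Definition central z := forall a, a * z = z * a.

Lemma centralB z z' : central z -> central z' -> central (z - z').
Proof. by move=> cz cz' a; rewrite mulrBr mulrBl cz cz'. Qed.

Lemma centralM z z' : central z -> central z' -> central (z * z').
Proof. by move=> cz cz' a; rewrite mulrA cz -mulrA cz' mulrA. Qed.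

Lemma central_scalar c : central c%:A.
Proof. by move=> a; rewrite mulr_algl mulr_algr. Qed.

Lemma central_C (b : bool) : central (g (gC b)).
Proof.
move=> a; elim/gind: a => [|a a' Ca Ca'|c a Ca|i a Ca].
- by rewrite mulr1 mul1r.
- by rewrite mulrDl mulrDr Ca Ca'.
- by rewrite -scalerAl -scalerAr Ca.
- by rewrite -mulrA Ca !mulrA (grel (rel_C_central q g b i)).
Qed.

(** The kernel of a central element is a submodule. This half of Schur's lemma replaces eigenvalues,
    which may fail to exist in [F]. *)
Lemma schur z : central z ->
  (forall v, z *: v = 0) \/ (forall v, z *: v = 0 -> v = 0).
Proof.
move=> cz; have [_ _ Mmin] := Msimple.
have [||E|E] := Mmin [set v | z *: v = 0]; last 2 first.
- by right=> v zv; have : [set v | z *: v = 0] v by []; rewrite E.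
- by left=> v; have : [set: M] v by []; rewrite -E.
- split=> /= [|u v zu zv|c u zu|a u _ zu]; first by rewrite scaler0.
  + by rewrite scalerDr zu zv addr0.
  + by rewrite scale_algC zu scaler0.
  + by rewrite scalerA -cz -scalerA zu scaler0.
- by [].
Qed.

Lemma natr_inj n v : n.+1%:R *: v = 0 -> v = 0.
Proof.
have n0 : n.+1%:R != 0 :> F by have /pcharf0P -> := F0.
by move=> nv; rewrite -(scale_algK v n0) [n.+1%:R%:A](scaler_nat n.+1 1) nv scaler0.
Qed.

(* The Weyl algebra has no representation on which a kills a nonzero vector that
   some power of b kills. *)
Lemma weyl_nilpotent a b z v n : central z -> a * b = b * a + z ->
  (forall u, z *: u = 0 -> u = 0) -> a *: v = 0 -> b ^+ n *: v = 0 -> v = 0.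
Proof.
move=> cz ab zinj av; elim: n => [|n IH bv]; first by rewrite expr0 scale1r.
(* The Leibniz rule for the commutator with a. Applied to v it gives (n + 1) z b^n v = 0, which
   lowers the exponent in characteristic 0. *)
have comm : a * b ^+ n.+1 = b ^+ n.+1 * a + (z * b ^+ n) *+ n.+1.
  elim: n {IH bv} => [|n IH]; first by rewrite !expr1 expr0 mulr1.
  rewrite [b ^+ n.+2]exprS mulrA ab mulrDl -(mulrA b) IH mulrDr mulrnAr !(mulrA b).
  by rewrite cz -(mulrA z) -!exprS -addrA [in RHS]mulrSr.
apply: IH; apply: zinj; apply: (@natr_inj n).
have := congr1 (fun c => c *: v) comm.
rewrite scalerDl -!scalerA av bv !scaler0 add0r => ->.
by rewrite scaler_nat scalerA scalerMnl.
Qed.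

Local Notation k b n := (g (gk b n)).
(** This is C - C^-1, as [gC] stands for the square roots. *)
Let Z := g (gC true) ^+ 2 - g (gC false) ^+ 2.

Lemma central_Z : central Z.
Proof. by apply: centralB; rewrite expr2; apply: centralM; exact: central_C. Qed.

(** For m = n = 1 the term r = 0 is the reordered product; for r = 1, the indices i = 0 and i = 1
    contribute C and C^-1 with opposite coefficients. *)
Lemma k1_comm : k false 1 * k true 1 = k true 1 * k false 1 + (q ^ 2 - q ^ (- 2)) *: Z.
Proof.
have q2 : q ^ (- 2) * q ^ 2 = 1 by rewrite -expfzDr.
have G0 : Gcoef q false 0 * Gcoef q true 0 = 1 by exact: q2.
have G01 : Gcoef q false 0 * Gcoef q true 1 = q ^ 2 - q ^ (- 2).
  rewrite GcoefS //; transitivity (q ^ (- 2) * ((q ^ 2 - q ^ (- 2)) * q ^ 2)) => //.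
  by rewrite mulrC -mulrA [q ^ 2 * _]mulrC q2 mulr1.
have G10 : Gcoef q false 1 * Gcoef q true 0 = - (q ^ 2 - q ^ (- 2)).
  rewrite GcoefS //; transitivity ((q ^ (- 2) - q ^ 2) * q ^ (- 2) * q ^ 2) => //.
  by rewrite -mulrA q2 mulr1 opprB.
have k0 : k true 0 * k false 0 = 1 by exact: (grel (rel_k0 q g true)).
rewrite (grel (rel_kmkp q g 1 1)) big_ord_recl !big_ord1 big_ord_recl big_ord1.
rewrite /= (_ : bump 0 0 = 1%N) // !subn0 subnn G0 G01 G10 scale1r.
rewrite (_ : Chalf g (- (2 * 0%:Z)) = 1) //.
rewrite !mul1r !mulr1 -!(mulrA (Chalf g _)) k0 !mulr1 scaleNr -scalerBr.
by congr (_ + _ *: _).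
Qed.

Lemma shift_mul a b c d : (a - c%:A) * (b - d%:A) =
  a * b - (d *: a + c *: b - (c * d)%:A).
Proof.
have e x y z t : x - y - (z - t) = x - (z + y - t) :> U.
  by rewrite -addrA; congr (_ + _); rewrite !opprB opprD [LHS]addrC addrA.
by rewrite mulrBr !mulrBl e !mulr_algr mulr_algl scalerA [d * c]mulrC.
Qed.

Lemma Z_act0 (W : set M) (kap : bool -> F) : stable_subspace (kgens g) W -> W != [set 0] ->
  (forall v, W v -> exists n, forall s : bool, (k s 1 - (kap s)%:A) ^+ n *: v = 0) ->
  forall v, Z *: v = 0.
Proof.
move=> SW Wn0 Wkap; have [W0 _ WZ _] := SW; have [w Ww w0] := nonzero_vector W0 Wn0.
have Wk (s : bool) v : W v -> W (k s 1 *: v).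
  by have [_] := iffLR (stable_kgensP g W) SW; apply.
have [//|Zinj] := schur central_Z.
pose a := k false 1 - (kap false)%:A; pose b := k true 1 - (kap true)%:A.
have c0 : q ^ 2 - q ^ (- 2) != 0.
  rewrite subr_eq0; apply: contra q4 => /eqP e.
  have -> : q ^+ 4 = q ^ 2 * q ^ 2 by rewrite -expfzDr.
  by rewrite {2}e -expfzDr // subrr.
pose z := (q ^ 2 - q ^ (- 2)) *: Z.
have cz : central z by move=> d; rewrite -scalerAl -scalerAr central_Z.
have zinj u : z *: u = 0 -> u = 0.
  by rewrite scale_algA => e; apply: Zinj; rewrite -(scale_algK (Z *: u) c0) e scaler0.
have ab : a * b = b * a + z.
  rewrite /a /b !shift_mul k1_comm -/z [kap true * _]mulrC addrAC.
  by congr (_ - (_ - _) + _); rewrite addrC.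
have [v [Wv v0 av]] : exists v, [/\ W v, v <> 0 & a *: v = 0].
  have [n /(_ false)] := Wkap w Ww; rewrite -/a.
  elim: n w Ww w0 => [|n IH] w Ww w0; first by rewrite expr0 scale1r.
  have [aw|aw] := pselect (a *: w = 0); first by exists w.
  rewrite exprSr -scalerA; apply: IH => //.
  by rewrite scalerBl; apply: (stable_subspaceB SW); [exact: Wk|exact: WZ].
have [n /(_ true) bv] := Wkap v Wv.
by case: v0; exact: (weyl_nilpotent cz ab zinj av bv).
Qed.

(** As (z - c)(z + c) = 0 on M, either z - c is zero, or it is injective and z + c is zero. *)
Lemma square_root_act c z : central z -> (forall v, z *: (z *: v) = (c ^+ 2)%:A *: v) ->
  exists2 d : F, d ^+ 2 = c ^+ 2 & forall v, z *: v = d%:A *: v.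
Proof.
move=> cz zz; have [zc|zc] := schur (centralB cz (central_scalar c)).
  by exists c => // v; apply/subr0_eq; rewrite -scalerBl.
exists (- c); first by rewrite sqrrN.
move=> v; apply/subr0_eq/zc.
rewrite scaleNr scaleNr opprK (scalerBl z) !scalerDr zz scale_algC scale_algM -expr2.
by rewrite [X in _ - X]addrC subrr.
Qed.

(** [Z] = 0 means C^2 = 1. Extracting square roots twice makes first C, then C^{1/2} scalar; the
    second time a square root of -1 may be required in [F]. *)
Lemma C_scalar (i : F) : i ^+ 2 = -1 -> (forall v, Z *: v = 0) ->
  exists2 e : F, e ^+ 4 = 1 & forall v, g (gC true) *: v = e%:A *: v.
Proof.
move=> i2 Z0; set c := g (gC true); pose c' := g (gC false).
have c4 v : (c * c) *: ((c * c) *: v) = (1 ^+ 2)%:A *: v.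
  have cc : c * c' = 1 by exact: (grel (rel_CCV q g)).
  have /subr0_eq : c ^+ 2 *: v - c' ^+ 2 *: v = 0 by rewrite -scalerBl; exact: Z0.
  rewrite !expr2 => ->; rewrite scalerA -mulrA [c * (c' * _)]mulrA cc mul1r cc.
  by rewrite mulr1 !scale1r.
have [d d2 cd] := square_root_act (centralM (central_C true) (central_C true)) c4.
have [e e2] : exists e, e ^+ 2 = d.
  move/eqP: d2; rewrite eqf_sqr => /orP[]/eqP->; last by exists i.
  by exists 1; rewrite expr1n.
have [|f f2 cf] := @square_root_act e c (central_C true).
  by move=> v; rewrite e2 -cd scalerA.
by exists f; rewrite // (exprM _ 2 2) f2 e2 d2 expr1n.
Qed.

End CentralCharacter.

(** * Invariance of the module notions under twisting *)

Section Twisting.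
Variables (F : fieldType) (U : algType F) (psi : {lrmorphism U -> U}) (M : lmodType U).
Local Notation N := (twist psi M).

Lemma twistE a (v : N) : a *: v = psi a *: (v : M) :> M.
Proof. by []. Qed.

Lemma twist_scalar c (v : N) : c%:A *: v = c%:A *: (v : M) :> M.
Proof. by rewrite twistE rmorph_alg. Qed.

Lemma twist_stable S (P : set M) :
  stable_subspace S (P : set N) <-> stable_subspace (psi @` S) P.
Proof.
split=> -[P0 PD PZ PS]; split=> //.
- by move=> c u Pu; rewrite -twist_scalar; exact: PZ.
- by move=> _ u [a Sa <-] Pu; exact: (PS a).
- by move=> c u Pu; rewrite twist_scalar; exact: PZ.
- by move=> a u Sa Pu; rewrite twistE; apply: PS => //; exists a.
Qed.

Lemma twist_finite_dim (P : set M) : finite_dim P -> finite_dim (P : set N).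
Proof.
move=> [n [e [Pe eP]]]; exists n, e; split=> // v /eP[c ->]; exists c.
by apply: eq_bigr => i _; rewrite twist_scalar.
Qed.

Lemma twist_irreducible S (P : set M) :
  irreducible_subspace (psi @` S) P -> irreducible_subspace S (P : set N).
Proof.
move=> [/twist_stable SP P0 Pmin]; split=> // Q /twist_stable SQ QP.
exact: Pmin.
Qed.

Lemma twist_indecomposable S (P : set M) :
  indecomposable (psi @` S) P -> indecomposable S (P : set N).
Proof.
move=> [/twist_stable SP P0 Pmin]; split=> // Q R /twist_stable SQ /twist_stable SR.
exact: Pmin.
Qed.

Lemma twist_locally_finite_dim S (P : set M) :
  locally_finite_dim (psi @` S) P -> locally_finite_dim S (P : set N).
Proof.
move=> lf v /lf[Q [/twist_stable SQ QP fQ Qv]]; exists Q; split=> //.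
exact: twist_finite_dim.
Qed.

Lemma twist_direct_sum (I : choiceType) (W : I -> set M) :
  direct_sum_decomposition W -> direct_sum_decomposition (W : I -> set N).
Proof. by []. Qed.

Lemma twist_nilpotent (a : U) (c d : F) n (v : M) : psi a = c *: a ->
  (a - d%:A) ^+ n *: v = 0 -> (a - (c * d)%:A) ^+ n *: (v : N) = 0.
Proof.
move=> psia av; have E : psi (a - (c * d)%:A) = c *: (a - d%:A).
  by rewrite rmorphB /= psia rmorph_alg scalerBr scalerA.
by rewrite twistE rmorphXn /= E exprZn (scale_algA (c ^+ n)) av scaler0.
Qed.

Lemma twist_fix (a : U) (c d : F) : psi a = c *: a -> c * d = 1 ->
  (forall v : M, a *: v = d%:A *: v) -> forall v : N, a *: v = v.
Proof.
by move=> psia cd av v; rewrite twistE psia scale_algA av scale_algM cd !scale1r.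
Qed.

Lemma twist_twist (phi : {lrmorphism U -> U}) :
  cancel phi psi -> isomorphic_modules M (twist phi N).
Proof.
move=> phiK; have lin : linear (fun v : M => v : twist phi N).
  (* The identity map is linear: in the double twist, a acts as psi (phi a) = a. *)
  by move=> a u v; congr (_ + _); rewrite -{1}[a]phiK.
pose m := GRing.isLinear.Build U M (twist phi N) *:%R (fun v : M => v : twist phi N) lin.
pose f : {linear M -> twist phi N} := HB.pack (fun v : M => v : twist phi N) m.
by exists f; exists (fun v => v).
Qed.

End Twisting.

(** * Rescaling automorphisms *)

(* The relations are homogeneous modulo 4 for this degree, so that e ^ degree
   defines an automorphism for every fourth root of unity e. *)
Definition gen_degree (x : gen) : int :=
  match x with
  | gC b => sgn b
  | gk b n => if b then 0 else 2 * n%:Z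
  | gx b m => sgn b * m
  end.

Section Rescaling.
Variables (F : fieldType) (q : F) (A : algType F) (g : gen -> A) (e : F).
Hypothesis e4 : e ^+ 4 = 1.
Hypothesis grel : forall l r, drinfeld_rel q g l r -> l = r.

Definition rescale (x : gen) : A := e ^ gen_degree x *: g x.

Let e0 : e != 0.
Proof. by apply/eqP => e0; move/eqP: e4; rewrite e0 expr0n eq_sym oner_eq0. Qed.

Let eM (m n : int) (x y : A) : (e ^ m *: x) * (e ^ n *: y) = e ^ (m + n) *: (x * y).
Proof. by rewrite -scalerAl -scalerAr scalerA expfzDr. Qed.

Let e_mod4 (m n c : int) : m = n + 4 * c -> e ^ m = e ^ n.
Proof.
by move=> ->; rewrite expfzDr // -exprz_exp [e ^ 4]e4 exp1rz mulr1.
Qed.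

Let Chalf_rescale j : Chalf rescale j = e ^ j *: Chalf g j.
Proof.
rewrite /Chalf /rescale /=; case: j => j; rewrite exprZn; congr (_ *: _).
by rewrite NegzE -[_ ^ - _]/(e ^- j.+1) -exprVn.
Qed.

Let kmode_rescale b n : kmode rescale b n = e ^ (if b then 0 else - (2 * n)) *: kmode g b n.
Proof.
rewrite /kmode; case: ifP => n0; last by rewrite scaler0.
rewrite /rescale /=; congr (e ^ _ *: _); case: b n0 => //; rewrite /sgn; lia.
Qed.

Let rescaleE x : rescale x = e ^ gen_degree x *: g x. Proof. by []. Qed.

(** Both sides of a relation have the same degree, except for multiples of 4 in [rel_kmkp], in
    [rel_kmx] for x^+, and in the k^- term of [rel_xpxm]; there e^4 = 1 enters. *)
Lemma rescale_rel l r : drinfeld_rel q rescale l r -> l = r.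
Proof.
case=> {l r} [b x||b m n|m n|b|b n m|b n m|b m n|m n].
- by rewrite !rescaleE !eM addrC (grel (rel_C_central _ _ _ _)).
- by rewrite !rescaleE !eM (grel (rel_CCV _ _)) subrr scale1r.
- by rewrite !rescaleE !eM addrC (grel (rel_kk _ _ _ _ _)).
- rewrite !rescaleE eM (grel (rel_kmkp _ _ _ _)) scaler_sumr; apply: eq_bigr => r _.
  rewrite scaler_sumr; apply: eq_bigr => i _.
  rewrite !Chalf_rescale !rescaleE !eM !scalerA mulrC; congr (_ * _ *: _).
  apply: (@e_mod4 _ _ i%:Z) => /=; have := ltn_ord r; have := ltn_ord i; lia.
- rewrite !rescaleE eM (grel (rel_k0 _ _ _)).
  by case: b => /=; rewrite mulr0 addr0 expr0z scale1r.
- rewrite [RHS]eM -(grel (rel_kpx _ _ _ _ _)) scaler_sumr; apply: eq_bigr => r _.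
  rewrite !Chalf_rescale !rescaleE !eM !scalerA mulrC; congr (e ^ _ * _ *: _) => /=.
  by lia.
- rewrite [LHS]eM (grel (rel_kmx _ _ _ _ _)) scaler_sumr; apply: eq_bigr => r _.
  rewrite !Chalf_rescale !rescaleE !eM !scalerA mulrC; congr (_ * _ *: _) => /=.
  apply: (@e_mod4 _ _ (if b then r%:Z else 0)).
  by have := ltn_ord r; case: b; rewrite /sgn; lia.
- rewrite !rescaleE !eM /= !scalerA ![q ^ _ * _]mulrC -!scalerA.
  have -> : sgn b * (m + 1) + sgn b * n = sgn b * m + sgn b * (n + 1) by lia.
  have -> : sgn b * n + sgn b * (m + 1) = sgn b * m + sgn b * (n + 1) by lia.
  have -> : sgn b * (n + 1) + sgn b * m = sgn b * m + sgn b * (n + 1) by lia.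
  by rewrite -!scalerBr (grel (rel_xx _ _ _ _ _)).
- rewrite !rescaleE !eM /= !Chalf_rescale !kmode_rescale !eM.
  have -> : sgn true * m + sgn false * n = m - n by rewrite /sgn; lia.
  have -> : sgn false * n + sgn true * m = m - n by rewrite /sgn; lia.
  rewrite addr0 (@e_mod4 (n - m + - (2 * (m + n))) (m - n) (- m)); last lia.
  by rewrite -!scalerBr (grel (rel_xpxm _ _ _ _)) !scalerA mulrC.
Qed.

End Rescaling.

(** * The algebra over K(q) *)

Lemma image_cancel (T : Type) (phi psi : T -> T) (S : set T) : cancel phi psi ->
  phi @` S `<=` S -> psi @` S `<=` S -> psi @` S = S.
Proof.
move=> phiK phiS psiS; apply/seteqP; split=> // a Sa.
by exists (phi a); [apply: phiS; exists a|exact: phiK].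
Qed.

Section Automorphism.
Variables (F : fieldType) (q : F) (U : algType F) (g : gen -> U).
Hypothesis grel : forall l r, drinfeld_rel q g l r -> l = r.
Hypothesis gind : forall P : U -> Prop, P 1 -> (forall a a', P a -> P a' -> P (a + a')) ->
  (forall c a, P a -> P (c *: a)) -> (forall i a, P a -> P (g i * a)) ->
  forall a, P a.
Hypothesis glift : forall g' : gen -> U, (forall l r, drinfeld_rel q g' l r -> l = r) ->
  {h : {lrmorphism U -> U} | forall x, h (g x) = g' x}.

Lemma rescale_cancel (e : F) (phi psi : {lrmorphism U -> U}) : e != 0 ->
  (forall x, phi (g x) = rescale g e x) -> (forall x, psi (g x) = rescale g e^-1 x) ->
  cancel phi psi.
Proof.
move=> e0 phiE psiE; elim/gind => [|a a' IH IH'|c a IH|i a IH].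
- by rewrite !rmorph1.
- by rewrite !rmorphD /= IH IH'.
- by rewrite !linearZ /= IH.
- rewrite !rmorphM /= IH phiE linearZ /= psiE /rescale scalerA.
  by rewrite -expfzMl mulfV // exp1rz scale1r.
Qed.

Lemma rescale_automorphism (e : F) : e ^+ 4 = 1 -> exists phi psi : {lrmorphism U -> U},
  [/\ forall x, phi (g x) = rescale g e x, forall x, psi (g x) = rescale g e^-1 x,
      cancel phi psi & cancel psi phi].
Proof.
move=> e4; have e4V : e^-1 ^+ 4 = 1 by rewrite exprVn e4 invr1.
have e0 : e != 0 by apply/eqP => e0; move/eqP: e4; rewrite e0 expr0n eq_sym oner_eq0.
have [phi phiE] := glift (rescale_rel e4 grel).
have [psi psiE] := glift (rescale_rel e4V grel).
exists phi, psi; split=> //; first exact: (rescale_cancel e0).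
by apply: (@rescale_cancel e^-1) => //; rewrite ?invr_eq0 ?invrK.
Qed.

End Automorphism.

Section FractionField.
Variable K : closedFieldType.
Local Notation F := {fraction {poly K}}.
Local Notation q := (qvar K).

Lemma qvarX n : (0 < n)%N -> q ^+ n != 1.
Proof.
move=> n0; rewrite -tofracXn -tofrac1 tofrac_eq; apply: contraTneq n0 => e.
by have := size_polyXn K n; rewrite e size_poly1 => -[<-].
Qed.

Lemma fraction_pchar0 : [pchar K] =i pred0 -> [pchar F] =i pred0.
Proof.
move=> /pcharf0P K0; apply/pcharf0P => n.
by rewrite -tofracMn tofrac_eq0 -polyC_natr polyC_eq0 K0.
Qed.

(** K(q) is not algebraically closed, but this root is a constant from [K]. *)
Lemma fraction_sqrtN1 : exists i : F, i ^+ 2 = -1.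
Proof.
have [x x2] := @solve_monicpoly K 2 (fun i => if i == 0%N then -1 else 0) isT.
exists (tofrac x%:P); rewrite -tofracXn -polyC_exp x2 !big_ord_recl big_ord0 /=.
by rewrite mul0r addr0 addr0 expr0 mulr1 polyCN tofracN tofrac1.
Qed.

Lemma kgens_Udot0 : kgens (Ugen K) `<=` @Udot0 K.
Proof. by move=> _ [p _ <-] S [_]; apply; right; exists p. Qed.

(** As [psi] only rescales generators, the preimage of any subalgebra containing those of [Udot0]
    contains them too. *)
Lemma lrmorphism_Udot0 (c : gen -> F) (psi : {lrmorphism Udot K -> Udot K}) :
  (forall x, psi (Ugen K x) = c x *: Ugen K x) -> psi @` @Udot0 K `<=` @Udot0 K.
Proof.
move=> psiE _ [a Ua <-] S [[S1 SB SM SZ] Sg].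
apply: (Ua [set a | S (psi a)]); split; first split=> [|x y Sx Sy|x y Sx Sy|d x Sx] /=.
- by rewrite rmorph1.
- by rewrite rmorphB; exact: SB.
- by rewrite rmorphM; exact: SM.
- by rewrite linearZ; exact: SZ.
- move=> _ [[b _ <-]|[p _ <-]] /=; rewrite psiE; apply: SZ; apply: Sg.
    by left; exists b.
  by right; exists p.
Qed.

End FractionField.

(** * Reduction of simple l-weight modules to type 1 *)

Section Main.
Variable K : closedFieldType.
Hypothesis K0 : [pchar K] =i pred0.
Local Notation F := {fraction {poly K}}.
Local Notation U := (Udot K).
Local Notation q := (qvar K).
Local Notation g := (Ugen K).
Local Notation S0 := (@Udot0 K).
Variable M : lmodType U.
Hypothesis Msimple : simple_module M.

Section Decomposed.
Variables (I : countType) (W : I -> set M) (kappa : I -> bool -> nat -> F).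
Hypothesis dec : lweight_decomposition W kappa.

Lemma lweight_space_stable a : stable_subspace (kgens g) (W a).
Proof.
case: (lweight_indecomposable dec a) => SW _ _.
exact: stable_subspaceW (@kgens_Udot0 K) SW.
Qed.

Lemma lweight_space_neq0 a : W a != [set 0].
Proof. by case: (lweight_indecomposable dec a). Qed.

Lemma lweight_C_scalar : exists2 e : F, e ^+ 4 = 1 &
  forall v : M, g (gC true) *: v = e%:A *: v.
Proof.
have [i i2] := fraction_sqrtN1 K; have [_ Mn0 _] := Msimple.
have [a _] := direct_sum_inhabited (lweight_direct_sum dec) Mn0.
apply: (C_scalar (@Ugen_rel K) (@Udot_ind K) Msimple i2).
apply: (Z_act0 (qvar_neq0 K) (qvarX K (isT : 0 < 4)%N) (fraction_pchar0 K0)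
  (@Ugen_rel K) (@Udot_ind K) Msimple (kap := fun b => kappa a b 1%N)
  (lweight_space_stable a) (lweight_space_neq0 a)).
by move=> v /(lweight_kappa dec)[n _ kn]; exists n => b; exact: kn.
Qed.

End Decomposed.

Lemma simple_lweight_twist : lweight M ->
  exists (phi : {lrmorphism U -> U}) (N : lmodType U),
    [/\ bijective phi, simple_module N, lweight N, type1 N
      & isomorphic_modules M (twist phi N)].
Proof.
move=> [I [W [kappa dec]]]; have [e e4 eC] := lweight_C_scalar dec.
have e0 : e != 0 by apply/eqP => e0; move/eqP: e4; rewrite e0 expr0n eq_sym oner_eq0.
have [phi [psi [phiE psiE phiK psiK]]] :=
  rescale_automorphism (@Ugen_rel K) (@Udot_ind K) (@Udot_lift K U) e4.
have psiT : psi @` [set: U] = [set: U].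
  exact: (image_cancel phiK).
have psi0 : psi @` S0 = S0.
  exact (image_cancel phiK (lrmorphism_Udot0 phiE) (lrmorphism_Udot0 psiE)).
(* [psi] rescales C^{1/2} by e^-1, which cancels the scalar e by which it acts on M. *)
exists phi, (twist psi M); split.
- exact (Bijective phiK psiK).
- by apply: twist_irreducible; rewrite psiT.
(* The l-weight spaces are unchanged, and their scalars follow the rescaling of the k^b_n; those of
   k^+_0 and k^-_0, of degree 0, stay the same. *)
- exists I, W, (fun a b n => e^-1 ^ gen_degree (gk b n) * kappa a b n); split.
  + exact: twist_direct_sum (lweight_direct_sum dec).
  + move=> a; apply: twist_indecomposable; rewrite psi0; exact: lweight_indecomposable dec a.
  + move=> a; apply: twist_locally_finite_dim; rewrite psi0.
    exact: lweight_locally_finite dec a.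
  + by move=> a; rewrite mul1r; exact: lweight_kappa_neq0 dec a.
  + by move=> a; rewrite !mul1r; exact: lweight_kappa_inv dec a.
  + move=> a v /(lweight_kappa dec)[n n0 kn]; exists n; first exact: n0.
    move=> b m; exact (twist_nilpotent (M := M) (psiE (gk b m)) (kn b m)).
- by apply: (twist_fix (psiE (gC true)) _ eC); exact: mulVf.
- exact (twist_twist M phiK).
Qed.

End Main.

Theorem theorem2p11 (K : closedFieldType) (charK0 : [pchar K] =i pred0) :
  [/\ forall M : lmodType (Udot K), simple_module M -> lweight M ->
        exists (phi : {lrmorphism Udot K -> Udot K}) (N : lmodType (Udot K)),
          [/\ bijective phi, simple_module N, lweight N, type1 N
            & isomorphic_modules M (twist phi N)],
      forall M : lmodType (Udot K), type1 M -> simple_module M ->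
        weight_finite M -> highest_lweight M
    & forall M : lmodType (Udot K), type1 M -> simple_module M ->
        weight_finite M -> finite_dim [set: M]%classic].
Proof.
have Wlf (M : lmodType (Udot K)) (I : countType) (W : I -> set M) kappa :
    lweight_decomposition W kappa -> forall a u, W a u -> exists L,
    [/\ stable_subspace (kgens (Ugen K)) L, L `<=` W a, finite_dim L & L u].
  move=> dec a u Wu; have [L [SL LW fL Lu]] := lweight_locally_finite dec Wu.
  by exists L; split=> //; exact: stable_subspaceW (@kgens_Udot0 K) SL.
split=> M; first by move=> Msimple; exact: simple_lweight_twist.
- move=> M1 Msimple [I [W [kappa [dec fin]]]].
  have [ss hw] := weight_finite_highest (qvar_neq0 K) (@qvarX K) (@Ugen_rel K) M1
    (lweight_direct_sum dec) (lweight_space_stable dec) (lweight_kappa dec)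
    (lweight_space_neq0 dec)
    (lweight_kappa_neq0 dec) (Wlf _ _ _ _ dec) fin (@Udot_ind K) Msimple.
  exact (And3 ss M1 hw).
- move=> M1 Msimple [I [W [kappa [dec fin]]]].
  exact: (weight_finite_finite_dim (qvar_neq0 K) (@qvarX K) (@Ugen_rel K) M1
    (lweight_direct_sum dec) (lweight_space_stable dec) (lweight_kappa dec)
    (lweight_space_neq0 dec)
    (lweight_kappa_neq0 dec) (Wlf _ _ _ _ dec) fin (@Udot_ind K) Msimple).
Qed.
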